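(* Let $(X,d,\mathfrak m)$ be a metric measure space and let $\Omega\subset X$ be an open subset. Then $\Omega$ is a $(\mathring{BV}\cap L^\infty,\|\cdot\|_{\mathring{BV}})$-extension set if and only if $\Omega$ has the extension property for sets of finite perimeter.
   Context: Standing assumption: a metric measure space $(X,d,\mathfrak m)$ consists of a complete separable metric space $(X,d)$ and a nonnegative Borel measure $\mathfrak m$ on $X$ that is finite on bounded sets. No doubling or Poincaré assumption is made. Slope: for $f\colon X\to\mathbb R$ (or $f$ defined on an open set), $\mathrm{lip} f(x)=\limsup_{y\to x}\frac{|f(y)-f(x)|}{d(x,y)}$, with $\mathrm{lip} f(x)=0$ if $x$ is isolated. $\mathrm{Lip}_{\rm loc}(A)$ denotes the locally Lipschitz functions on the open set $A$. Local integrability: $L^1_{\rm loc}(\mathfrak m)$ is the set of ($\mathfrak m$-a.e. classes of) measurable functions $f$ such that every $x\in X$ has an open neighbourhood $U$ with $f\in L^1(\mathfrak m|_U)$; $f_n\to f$ in $L^1_{\rm loc}(\mathfrak m)$ means every $x\in X$ has an open neighbourhood $U$ with $f_n\to f$ in $L^1(\mathfrak m|_U)$. For Borel $B\subset X$, $L^1_{\rm loc}(\mathfrak m|_B)$ is defined in the same way using the measure $\mathfrak m|_B$ on $X$. Total variation: for $f\in L^1_{\rm loc}(\mathfrak m)$ and $A\subset X$ open, $$|Df|(A)=\inf\Big\{\liminf_{n}\int_A \mathrm{lip} f_n\,d\mathfrak m:\ f_n\in \mathrm{Lip}_{\rm loc}(A),\ f_n\to f\text{ in }L^1_{\rm loc}(\mathfrak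 m|_A)\Big\},$$ and for Borel $B\subset X$, $|Df|(B)=\inf\{|Df|(A): B\subset A,\ A\text{ open}\}$. For Borel $B\subset X$ and $u\in L^1_{\rm loc}(\mathfrak m|_B)$, $|Du|_B$ denotes the total variation of $u$ computed in the metric measure space $(X,d,\mathfrak m|_B)$. Spaces: for Borel $B\subset X$, $\mathring{BV}(B)=\{u\in L^1_{\rm loc}(\mathfrak m|_B): |Du|_B(B)<\infty\}$ with seminorm $\|u\|_{\mathring{BV}(B)}=|Du|_B(B)$. $L^\infty(B)$ is the space of $\mathfrak m$-essentially bounded functions on $B$. Extension set: $\Omega$ is a $(\mathring{BV}\cap L^\infty,\|\cdot\|_{\mathring{BV}})$-extension set if there exist $C>0$ and a (not necessarily linear) map $E\colon \mathring{BV}(\Omega)\cap L^\infty(\Omega)\to \mathring{BV}(X)\cap L^\infty(X)$ such that for every $u\in\mathring{BV}(\Omega)\cap L^\infty(\Omega)$: $\|Eu\|_{\mathring{BV}(X)}\le C\|u\|_{\mathring{BV}(\Omega)}$ and $Eu|_\Omega=u$ ($\mathfrak m$-a.e.). Perimeter: for Borel $E\subset X$ and Borel $B$, $P(E,B)=|D\chi_E|(B)$. A Borel set $E\subset \Omega$ has finite perimeter on $\Omega$ if $P_\Omega(E):=|D\chi_E|_\Omega(\Omega)<\infty$. Extension property for sets of finite perimeter: there exists $C>0$ such that for every Borel $E\subset\Omega$ of finite perimeter on $\Omega$ there is a Borel set $\tilde E\subset X$ with $P(\tilde E,X)\le C\,P_\Omega(E)$ and $\mathfrak m(E\,\Delta\,(\tilde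 E\cap\Omega))=0$. *)

(* Defs.v *)
From HB Require Import structures.
From mathcomp Require Import all_boot all_order all_algebra.
From mathcomp Require Import all_classical all_reals all_analysis.

Set Implicit Arguments.
Unset Strict Implicit.
Unset Printing Implicit Defensive.

Import Order.TTheory GRing.Theory Num.Theory.
Import numFieldNormedType.Exports.

Local Open Scope classical_set_scope.
Local Open Scope ring_scope.

HB.mixin Record isBorel d T & Topological T & Measurable d T := {
  borelE : @measurable d T = <<s [set A : set T | open A] >>
}.

(* Complete metric spaces endowed with their Borel sigma-algebra (nonempty,
   since the library's complete and measurable types are pointed). *)
#[short(type="completeMetricBorelType")]
HB.structure Definition CompleteMetricBorel (R : realType) d :=
  { T of Metric R T & Complete T & Measurable d T & isBorel d T }.

Definition separable (T : topologicalType) : Prop :=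
  exists2 D : set T, countable D & dense D.

Section bv.
Context (R : realType) (d : measure_display) (X : completeMetricBorelType R d).
Implicit Types (f u v : X -> R) (A B E : set X) (mu m : {measure set X -> \bar R}).

Lemma open_borel A : open A -> measurable A.
Proof. by rewrite borelE => oA; exact: sub_gen_smallest. Qed.

Definition finite_on_bounded m : Prop :=
  forall A, measurable A -> (exists (x : X) (r : R), A `<=` ball x r) ->
    (m A < +oo)%E.

(* At isolated points the deleted neighbourhood filter contains the empty set
   and the limsup would be -oo, hence the case distinction. When f only matters
   on an open set A, slope f x with x in A depends only on f restricted to A. *)
Definition slope f (x : X) : \bar R :=
  if `[< isolated [set: X] x >] then 0%E
  else limf_esup (fun y => (`|f y - f x| / mdist y x)%:E) x^'.

Definition locally_lipschitz A f : Prop :=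
  forall x, A x -> exists U : set X, [/\ open U, U x, U `<=` A &
    exists L : R, forall y z, U y -> U z -> `|f y - f z| <= L * mdist y z].

(* Functions are representatives of a.e. classes. *)
Definition L1loc mu u : Prop := measurable_fun setT u /\
  forall x : X, exists U : set X,
    [/\ open U, U x & mu.-integrable U (EFin \o u)].

(* Convergence in L^1_loc of mu restricted to A: the neighbourhoods U are those
   of all points of X, and L^1 of (mu restricted to A) restricted to U is L^1 of
   mu on A `&` U, so that the values of the f n outside A are irrelevant. *)
Definition L1loc_cvg mu A (f : (X -> R)^nat) u : Prop :=
  forall x : X, exists U : set X, [/\ open U, U x,
    mu.-integrable (A `&` U) (EFin \o u),
    forall n, mu.-integrable (A `&` U) (EFin \o f n) &
    (\int[mu]_(y in A `&` U) `|f n y - u y|%:E)%E @[n --> \oo] --> 0%E].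

Definition tvar_open mu u A : \bar R :=
  ereal_inf [set limn_einf (fun n => \int[mu]_(x in A) slope (f n) x)%E
    | f in [set f : (X -> R)^nat |
        (forall n, locally_lipschitz A (f n)) /\ L1loc_cvg mu A f u]].

(* tvar_open mu u is nondecreasing, so this extends it from open sets. *)
Definition tvar mu u B : \bar R :=
  ereal_inf [set tvar_open mu u A | A in [set A | open A /\ B `<=` A]].

(* |Du|_B(B), where |Du|_B is the total variation in (X, d, m restricted to B) *)
Definition bv_norm m B (mB : measurable B) u : \bar R := tvar (mrestr m mB) u B.

Definition BV m B (mB : measurable B) u : Prop :=
  L1loc (mrestr m mB) u /\ (bv_norm m mB u < +oo)%E.

Definition BV_Linfty m B (mB : measurable B) u : Prop :=
  BV m mB u /\ u \in Lfun (mrestr m mB) +oo%E.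

(* The last condition says that Ext is a map of a.e. classes. *)
Definition BV_Linfty_extension_set m B (mB : measurable B) : Prop :=
  exists2 C : R, 0 < C & exists Ext : (X -> R) -> (X -> R),
    (forall u, BV_Linfty m mB u ->
      [/\ BV_Linfty m measurableT (Ext u),
          (bv_norm m measurableT (Ext u) <= C%:E * bv_norm m mB u)%E &
          ae_eq m B (Ext u) u]) /\
    (forall u v, BV_Linfty m mB u -> BV_Linfty m mB v ->
      ae_eq m B u v -> ae_eq m setT (Ext u) (Ext v)).

Definition perimeter m E B : \bar R := tvar m \1_E B.

Definition perimeter_in m B (mB : measurable B) E : \bar R :=
  bv_norm m mB \1_E.

Definition perimeter_extension_property m B (mB : measurable B) : Prop :=
  exists2 C : R, 0 < C &
    forall E, measurable E -> E `<=` B -> (perimeter_in m mB E < +oo)%E ->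
      exists E' : set X, [/\ measurable E',
        (perimeter m E' setT <= C%:E * perimeter_in m mB E)%E &
        m (E `+` (E' `&` B)) = 0%E].

End bv.

(* Main.v *)
Require Import Defs.
From HB Require Import structures.
From mathcomp Require Import all_boot all_order all_algebra.
From mathcomp Require Import all_classical all_reals all_analysis.
From mathcomp Require Import measurable_realfun ess_sup_inf.
From mathcomp Require Import ring lra.
Set Implicit Arguments.
Unset Strict Implicit.
Unset Printing Implicit Defensive.
Import Order.TTheory GRing.Theory Num.Theory.
Import numFieldNormedType.Exports.
Local Open Scope classical_set_scope.
Local Open Scope ring_scope.

(** Sets and functions are linked by the coarea inequality, used as a selection
    principle: every interval [a, b) contains a level t with

      (b - a) P({u > t}) <= |D(max(a, min(u, b)))|          (coarea_level).

    From functions to sets, extend the indicator of E to a function w on X. For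
    0 <= t < 1 the set {w > t} agrees with E on Omega up to a null set, and a
    good level t in [0, 1) gives P({w > t}) <= |Dw|(X).

    From sets to functions, an affine change of variable reduces to functions u
    with values in [0, 1] (extend_unit_valued). Cut [0, 1] into n intervals,
    choose a good level in each of them, extend the n superlevel sets and
    average the indicators of the extensions. The average has values in [0, 1],
    is 1/n-close to u on Omega, and has variation at most C |Du|, because the
    variations of the truncations of u to the n intervals add up to at most
    |Du|. Since no doubling or Poincare inequality gives compactness in
    L^1, the limit as n grows comes from convexity: the functions with these three properties form nonempty convex
    sets that decrease with n, and their elements of almost minimal L^2 norm are
    a Cauchy sequence by the parallelogram identity (nested_convex_cluster).
    Lower semicontinuity passes the bound on the variation to the limit, which
    equals u on Omega.

    The total variation of a bounded function is studied through a finite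
    measure nu that controls the given measure mu on balls (finite_weight):
    |Du|(A) <= W exactly when, for every e > 0, some locally Lipschitz function f
    is e-close to u in L^1(nu) and has a slope with integral at most W + e over A
    (tvar_open_leP). Lower semicontinuity, convexity and the superadditivity

      |D(max(a, min(u, b)))| + |D(max(b, min(u, c)))| <= |Du|

    are then checked on the functions f (tvar_open_lsc, tvar_open_comb,
    tvar_open_clampD). The coarea selection follows from them without any
    integration over the levels. If all the superlevel sets with level in [a, b)
    had perimeter larger than K, the average of |Du| over the interval, then by
    lower semicontinuity every level t would start an interval [t, t + h] whose
    truncation has variation larger than K h (superlevel_clamp), and these
    contributions would add up to more than is available on [a, b]
    (superadditive_growth). *)

(** * A finite measure comparable with the given one on balls *)

Section weight.
Context (R : realType) (d : measure_display) (X : completeMetricBorelType R d).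
Implicit Types (m : {measure set X -> \bar R}) (A D S U : set X).

Lemma open_ballX (x : X) (r : R) : open (ball x r).
Proof.
rewrite ballEmdist openE => y /= xyr.
rewrite /interior -nbhs_ballE; exists (r - mdist x y) => /=; first by rewrite subr_gt0.
move=> z; rewrite ballEmdist /= => yz.
by rewrite (le_lt_trans (metric_triangle x y z))// -ltrBrDl.
Qed.

Lemma measurable_ballX (x : X) (r : R) : measurable (ball x r).
Proof. by apply: open_borel; exact: open_ballX. Qed.

(** A single L^1 space in which to read L^1_loc convergence of bounded functions:
    nu is finite, so that bounded functions are integrable, and it is bounded
    below by a multiple of m on each ball of a countable exhaustion of X. *)
Definition finite_weight m (nu : {measure set X -> \bar R}) :=
  [/\ (nu setT < +oo)%E,
      forall S, measurable S -> (nu S <= m S)%E &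
      forall n, exists2 c : R, 0 < c & forall S, measurable S ->
        (c%:E * m (S `&` ball point n%:R) <= nu S)%E].

(** Sum the restrictions of m to the balls of radius n about a fixed point, with
    weights 2^-(n+1) / (1 + m(ball)): the factors 2^-(n+1) add up to 1, whence
    nu <= m, and the denominators bound the total mass of nu by 1. *)
Lemma finite_weight_exists m : finite_on_bounded m ->
  exists nu, finite_weight m nu.
Proof.
move=> finm.
pose B n : set X := ball point n%:R.
have mB n : measurable (B n) by exact: measurable_ballX.
have Bfin n : m (B n) \is a fin_num.
  by rewrite ge0_fin_numE//; apply: finm => //; exists point, n%:R.
pose c n : R := (2 ^ n.+1)%:R^-1 / (1 + fine (m (B n))).
have c1 n : 0 < 1 + fine (m (B n)) by rewrite ltr_pwDl// fine_ge0.
have c0 n : 0 < c n by rewrite divr_gt0// invr_gt0 ltr0n expn_gt0.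
pose nu_ n : {measure set X -> \bar R} :=
  mscale (NngNum (ltW (c0 n))) (mrestr m (mB n)).
have nuE n S : nu_ n S = ((c n)%:E * m (S `&` B n))%E by [].
exists (mseries nu_ 0); split.
- rewrite (@le_lt_trans _ _ (\sum_(0 <= n <oo) (1 / (2 ^ n.+1)%:R)%:E)%E)//.
    apply: lee_nneseries => // n _; rewrite nuE setTI -(fineK (Bfin n)) -EFinM lee_fin.
    rewrite /c mulrAC -mulrA div1r ler_piMr ?invr_ge0// ler_pdivrMr// mul1r.
    by rewrite lerDr.
  by rewrite (le_lt_trans (epsilon_trick0 _ _))// ltry.
- move=> S mS.
  have [->|Sfin] := eqVneq (m S) +oo%E; first by rewrite leey.
  have {}Sfin : m S \is a fin_num by rewrite ge0_fin_numE// ltey.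
  apply: (@le_trans _ _ (\sum_(0 <= n <oo) (fine (m S) / (2 ^ n.+1)%:R)%:E)%E).
    apply: lee_nneseries => // n _; rewrite nuE.
    rewrite [leRHS]EFinM fineK// muleC; apply: lee_pmul => //.
    - by rewrite lee_fin ltW.
    - by apply: le_measure; rewrite ?inE//; exact: measurableI.
    - rewrite lee_fin /c ler_pdivrMr// ler_peMr ?invr_ge0//.
      by rewrite lerDl fine_ge0.
  by rewrite (le_trans (epsilon_trick0 _ _)) ?fine_ge0// fineK.
- move=> n; exists (c n) => // S mS.
  change (nu_ n S <= \sum_(0 <= k <oo) nu_ k S)%E.
  rewrite (@nneseriesD1 _ (fun k => nu_ k S) n xpredT)//.
  by rewrite leeDl// nneseries_ge0.
Qed.

Lemma integral_weight_le m (nu : {measure set X -> \bar R}) D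
    (f : X -> \bar R) :
  measurable D ->
  (forall S, measurable S -> (nu S <= m S)%E) ->
  measurable_fun D f -> (forall x, D x -> (0 <= f x)%E) ->
  (\int[nu]_(x in D) f x <= \int[m]_(x in D) f x)%E.
Proof.
move=> mD num mf f0.
rewrite integral_mkcond [leRHS]integral_mkcond.
apply: ge0_le_measure_integral => //.
  by move=> x; rewrite patchE; case: ifPn => // /[!inE]; exact: f0.
by apply/(measurable_restrictT f mD).
Qed.

Lemma integral_weight_ge m (nu : {measure set X -> \bar R}) D U
    (f : X -> \bar R) (c : R) :
  measurable D -> measurable U -> 0 < c ->
  (forall S, measurable S -> (c%:E * m (S `&` U) <= nu S)%E) ->
  measurable_fun D f -> (forall x, D x -> (0 <= f x)%E) ->
  (c%:E * \int[m]_(x in D `&` U) f x <= \int[nu]_(x in D) f x)%E.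
Proof.
move=> mD mU c0 cnu mf f0.
have mDU : measurable (D `&` U) by exact: measurableI.
rewrite (@eq_measure_integral _ _ _ _ (mrestr m mU)); last first.
  move=> S mS SDU; rewrite /= /mrestr; congr (m _).
  by apply/esym/setIidl => x /SDU[].
have -> : (c%:E = (NngNum (ltW c0))%:num%:E)%E by [].
rewrite -ge0_integral_mscale//; last 2 first.
- by apply: measurable_funS mf => // x [].
- by move=> x [] /f0.
apply: (@le_trans _ _ (\int[mscale (NngNum (ltW c0)) (mrestr m mU)]_(x in D) f x)%E).
  by apply: ge0_subset_integral => // x [].
exact: integral_weight_le.
Qed.

End weight.

(** * The slope of a locally Lipschitz function *)

Section slope.
Context (R : realType) (d : measure_display) (X : completeMetricBorelType R d).
Implicit Types (f g h : X -> R) (A : set X) (x y : X).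

Lemma isolated_near x : isolated [set: X] x -> \forall y \near x, y = x.
Proof. by case=> _ [V nV]; rewrite setIT => VE; apply: filterS nV => y; rewrite VE. Qed.

Lemma slope_ge0 f x : (0 <= slope f x)%E.
Proof.
rewrite /slope; case: asboolP => // nix.
apply: le_ereal_inf_tmp => _ [V xV <-].
have {}xV : \forall y \near x, y != x -> V y by exact: xV.
have [y Vy] : exists y, V y.
  apply: contrapT => V0; apply: nix; split; first by rewrite inE.
  exists [set x]; last by rewrite setIT.
  apply: filterS xV => y /= yV; have [->//|yx] := eqVneq y x.
  by exfalso; apply: V0; exists y; exact: yV.
by apply: le_ereal_sup_tmp; exists (`|f y - f x| / mdist y x)%:E; [exists y|];
  rewrite ?lee_fin ?divr_ge0// mdist_ge0.
Qed.

(** This comparison and the next one replace the limit superior in all later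
    arguments. They use full neighbourhoods of x, where the quotient is replaced
    by a product, and so cover isolated points without a case distinction. *)
Lemma slope_lt_near f x (c : R) : (slope f x < c%:E)%E ->
  \forall y \near x, `|f y - f x| <= c * mdist y x.
Proof.
rewrite /slope; case: asboolP => [ix c0|nix].
  by apply: filterS (isolated_near ix) => y ->; rewrite subrr normr0 mdistxx mulr0.
move=> /ereal_inf_lt[_ [V xV <-]] supV.
have {}xV : \forall y \near x, y != x -> V y by exact: xV.
apply: filterS xV => y /= yV; have [->|yx] := eqVneq y x.
  by rewrite subrr normr0 mdistxx mulr0.
rewrite -ler_pdivrMr ?mdist_gt0//.
rewrite -lee_fin (le_trans _ (ltW supV))//; apply: ereal_sup_ubound.
by exists y => //; exact: yV.
Qed.

Lemma slope_le_near f x (c : R) : 0 <= c ->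
  (forall e, 0 < e -> \forall y \near x, `|f y - f x| <= (c + e) * mdist y x) ->
  (slope f x <= c%:E)%E.
Proof.
move=> c0 fc; rewrite /slope; case: asboolP => [|nix]; first by rewrite lee_fin.
apply/lee_addgt0Pr => e e0; rewrite -EFinD.
apply: ge_ereal_inf => /=.
pose V := [set y : X | y != x /\ `|f y - f x| <= (c + e) * mdist y x].
exists (ereal_sup [set (`|f y - f x| / mdist y x)%:E | y in V]).
  exists V => //; rewrite /V /dnbhs /within/=.
  by apply: filterS (fc _ e0) => y.
apply: ge_ereal_sup => _ [y [yx fy] <-].
by rewrite lee_fin ler_pdivrMr// mdist_gt0.
Qed.

(** The common source of the slope estimates for constants, truncations and
    nonnegative linear combinations. *)
Lemma slope_le_comb f g h x (a b : R) : 0 <= a -> 0 <= b ->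
  (slope f x < +oo)%E -> (slope g x < +oo)%E ->
  (\forall y \near x, `|h y - h x| <= a * `|f y - f x| + b * `|g y - g x|) ->
  (slope h x <= a%:E * slope f x + b%:E * slope g x)%E.
Proof.
move=> a0 b0 fx gx hfg.
have [r rE] : exists r, slope f x = r%:E.
  by exists (fine (slope f x)); rewrite fineK// ge0_fin_numE// slope_ge0.
have [s sE] : exists s, slope g x = s%:E.
  by exists (fine (slope g x)); rewrite fineK// ge0_fin_numE// slope_ge0.
have r0 : 0 <= r by rewrite -lee_fin -rE slope_ge0.
have s0 : 0 <= s by rewrite -lee_fin -sE slope_ge0.
rewrite rE sE -!EFinM -EFinD; apply: slope_le_near.
  by rewrite addr_ge0// mulr_ge0.
move=> e e0.
pose e' := e / (a + b + 1).
have ab1 : 0 < a + b + 1 by rewrite ltr_wpDl// addr_ge0.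
have e'0 : 0 < e' by rewrite divr_gt0.
have fN : \forall y \near x, `|f y - f x| <= (r + e') * mdist y x.
  by apply: slope_lt_near; rewrite rE lte_fin ltrDl.
have gN : \forall y \near x, `|g y - g x| <= (s + e') * mdist y x.
  by apply: slope_lt_near; rewrite sE lte_fin ltrDl.
apply: filterS3 hfg fN gN => y Hh /(ler_wpM2l a0) Hf /(ler_wpM2l b0) Hg.
apply: (le_trans Hh); apply: (le_trans (lerD Hf Hg)).
rewrite !mulrA -mulrDl; apply: ler_wpM2r; first exact: mdist_ge0.
have : (a + b) * e' <= e.
  rewrite /e' mulrA ler_pdivrMr// mulrC; apply: ler_wpM2l; first exact: ltW.
  by rewrite lerDl.
rewrite !mulrDr mulrDl; lra.
Qed.

Lemma locally_lipschitz_slope A f x : locally_lipschitz A f -> A x ->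
  (slope f x < +oo)%E.
Proof.
move=> lf Ax; have [U [oU Ux UA [L LU]]] := lf x Ax.
apply: (@le_lt_trans _ _ `|L|%:E); last exact: ltry.
apply: slope_le_near => // e e0.
have : nbhs x U by apply: open_nbhs_nbhs.
apply: filterS => y Uy; apply: (le_trans (LU _ _ Uy Ux)).
apply: ler_wpM2r; first exact: mdist_ge0.
by rewrite (le_trans (ler_norm _))// lerDl ltW.
Qed.

Lemma locally_lipschitz_near A f x (e : R) : locally_lipschitz A f -> A x ->
  0 < e -> \forall y \near x, `|f y - f x| < e.
Proof.
move=> lf Ax e0; have [U [oU Ux UA [L LU]]] := lf x Ax.
have : nbhs x U by apply: open_nbhs_nbhs.
have L1 : 0 < `|L| + 1 by rewrite ltr_wpDl.
have : nbhs x (ball x (e / (`|L| + 1))).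
  by apply: nbhsx_ballx; rewrite divr_gt0.
apply: filterS2 => y; rewrite ballEmdist/= => xy Uy.
apply: (le_lt_trans (LU _ _ Uy Ux)).
rewrite metric_sym; apply: (@le_lt_trans _ _ ((`|L| + 1) * mdist x y)).
  apply: ler_wpM2r; first exact: mdist_ge0.
  by rewrite (le_trans (ler_norm _))// lerDl ltW.
by rewrite mulrC -ltr_pdivlMr.
Qed.

Lemma locally_lipschitz_comb A f g h (a b : R) : 0 <= a -> 0 <= b ->
  locally_lipschitz A f -> locally_lipschitz A g ->
  (forall x y, `|h y - h x| <= a * `|f y - f x| + b * `|g y - g x|) ->
  locally_lipschitz A h.
Proof.
move=> a0 b0 lf lg hfg x Ax.
have [U [oU Ux UA [L LU]]] := lf x Ax.
have [V [oV Vx VA [M MV]]] := lg x Ax.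
exists (U `&` V); split => //; first exact: openI.
  by move=> y [/UA].
exists (a * L + b * M) => y z [Uy Vy] [Uz Vz].
apply: (le_trans (hfg _ _)).
by rewrite mulrDl -!mulrA; apply: lerD; apply: ler_wpM2l => //;
  [exact: LU|exact: MV].
Qed.

Lemma measurable_locally_lipschitz A f : open A -> locally_lipschitz A f ->
  measurable_fun A f.
Proof.
move=> oA lf.
apply: (measurability _ (RGenOInfty.measurableE R)).
move=> _ [_ [r ->] <-]; apply: open_borel.
rewrite openE => x [Ax /=]; rewrite in_itv/= andbT => rx.
rewrite /interior.
have : \forall y \near x, `|f y - f x| < f x - r.
  by apply: (locally_lipschitz_near lf Ax); rewrite subr_gt0.
have : nbhs x A by apply: open_nbhs_nbhs.
apply: filterS2 => y Ay; rewrite ltr_norml => /andP[fy _]; split => //=.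
by rewrite in_itv/= andbT; lra.
Qed.

(** For r >= 0, the slope at x exceeds r when for some k the difference quotient
    exceeds r + 1/(k+1) at points y arbitrarily close to x. Under a fixed bound
    on the distance from y to x this is an open condition on x, by continuity
    of f; testing y in A only is enough because A is open. *)
Lemma measurable_slope A f : open A -> locally_lipschitz A f ->
  measurable_fun A (slope f).
Proof.
move=> oA lf.
pose O (q : R) n := [set x | A x /\ exists y, [/\ A y, mdist x y < n.+1%:R^-1 &
  q * mdist y x < `|f y - f x| ] ].
have oO q n : 0 <= q -> open (O q n).
  move=> q0; rewrite openE => x [Ax [y [Ay xyn qy]]]; rewrite /interior.
  (* Moving x by less than e changes the distance to y by less than e, and the
     increment of f by less than e. *)
  pose e := Num.min (n.+1%:R^-1 - mdist x y) ((`|f y - f x| - q * mdist y x) / (q + 1)).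
  have q1 : 0 < q + 1 by rewrite ltr_wpDl.
  have e0 : 0 < e by rewrite lt_min subr_gt0 xyn divr_gt0// subr_gt0.
  have xA : nbhs x A by apply: open_nbhs_nbhs.
  have := locally_lipschitz_near lf Ax e0 => fe.
  have : nbhs x (ball x e) by exact: nbhsx_ballx.
  apply: filterS3 xA fe => z Az fz; rewrite ballEmdist/= => xze.
  split => //; exists y; split => //.
    rewrite (le_lt_trans (metric_triangle z x y))//.
    rewrite -ltrBrDr metric_sym (lt_le_trans xze)// /e ge_min.
    by rewrite lexx.
  have ez : mdist y z < mdist y x + e.
    by rewrite (le_lt_trans (metric_triangle y x z))// ltrD2l.
  have fyz : `|f y - f x| - e < `|f y - f z|.
    rewrite ltrBlDr; apply: (@le_lt_trans _ _ (`|f y - f z| + `|f z - f x|)).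
      by rewrite (le_trans _ (ler_normD _ _))// addrA subrK.
    by rewrite ltrD2l.
  have : e * (q + 1) <= `|f y - f x| - q * mdist y x.
    by rewrite -ler_pdivlMr// /e ge_min lexx orbT.
  have : q * mdist y z <= q * (mdist y x + e) by apply: ler_wpM2l => //; exact: ltW.
  rewrite mulrDr mulrDr mulr1 [e * q]mulrC.
  move: fyz; move: (`|f y - f x|) (`|f y - f z|) (q * _) (q * _) (q * _) => a b c' d' e'; lra.
apply: (measurability _ (ErealGenOInfty.measurableE R)).
move=> _ [_ [r ->] <-].
have [r0|r0] := ltP r 0.
  rewrite (_ : _ `&` _ = A); first exact: open_borel.
  apply/seteqP; split => [x []//|x Ax]; split => //=.
  by rewrite in_itv/= andbT (lt_le_trans _ (slope_ge0 f x))// lte_fin.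
rewrite (_ : _ `&` _ = A `&` \bigcup_k \bigcap_n O (r + k.+1%:R^-1) n).
  apply: measurableI; first exact: open_borel.
  apply: bigcup_measurable => k _; apply: bigcap_measurable => // n _.
  apply: open_borel; apply: oO; by rewrite addr_ge0// invr_ge0.
apply/seteqP; split => x [Ax]/=; rewrite in_itv/= andbT => rx; split => //.
  (* The slope is finite on A, which leaves room for some 1/(k+1). *)
  have [k rk] : exists k, ((r + k.+1%:R^-1)%:E < slope f x)%E.
    have [s sE] : exists s, slope f x = s%:E.
      exists (fine (slope f x)).
      by rewrite fineK// ge0_fin_numE ?slope_ge0// (locally_lipschitz_slope lf).
    move: rx; rewrite sE lte_fin => rs.
    have rs0 : 0 < s - r by rewrite subr_gt0.
    have [k _ /(_ _ (leqnn _)) /= ks] := near_infty_natSinv_lt (PosNum rs0).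
    by exists k; rewrite lte_fin -ltrBrDl.
  exists k => // n _; split => //.
  apply: contrapT => Hn; move: rk; rewrite ltNge => /negP; apply.
  have qge0 : 0 <= r + k.+1%:R^-1 by rewrite addr_ge0// invr_ge0.
  apply: slope_le_near => // e e0.
  have xA : nbhs x A by apply: open_nbhs_nbhs.
  have : nbhs x (ball x n.+1%:R^-1) by apply: nbhsx_ballx; rewrite invr_gt0.
  apply: filterS2 xA => y Ay; rewrite ballEmdist/= => xy.
  rewrite leNgt; apply/negP => qy; apply: Hn; exists y; split => //.
  by apply: le_lt_trans qy; apply: ler_wpM2r; [exact: mdist_ge0|rewrite lerDl ltW].
case: rx => k _ Ok; rewrite ltNge; apply/negP => sr.
have : (slope f x < (r + k.+1%:R^-1)%:E)%E.
  by rewrite (le_lt_trans sr)// lte_fin ltrDl invr_gt0.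
move=> /slope_lt_near/nbhs_ballP[e /= e0 eB].
have [n _ /(_ _ (leqnn _)) /= ne] := near_infty_natSinv_lt (PosNum e0).
have [_ [y [Ay xy]]] := Ok n I.
rewrite ltNge => /negP; apply; apply: eB.
by rewrite ballEmdist/= (lt_trans xy).
Qed.

End slope.

(** * Truncations, lower limits and distances in L^1 *)

Section clamp.
Context (R : realType).
Implicit Types a b c s t e : R.

Definition clamp a b t : R := Num.max a (Num.min t b).

Local Ltac case_minmax := repeat (match goal with
  | |- context [Order.min ?x ?y] => case: (leP x y) => ?
  | |- context [Order.max ?x ?y] => case: (leP x y) => ? end).

Lemma clamp_lip a b s t : `|clamp a b s - clamp a b t| <= `|s - t|.
Proof.
have st : s - t <= `|s - t| by exact: ler_norm.
have ts : t - s <= `|s - t| by rewrite distrC ler_norm.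
have st0 : 0 <= `|s - t| by [].
rewrite ler_norml; move: `|s - t| st ts st0 => n st ts n0; apply/andP.
by rewrite /clamp; case_minmax; split; lra.
Qed.

Lemma clamp_bound a b t M : `|a| <= M -> `|b| <= M -> `|clamp a b t| <= M.
Proof.
rewrite !ler_norml => /andP[? ?] /andP[? ?]; apply/andP.
by rewrite /clamp; case_minmax; split; lra.
Qed.

Lemma clamp_id a b t : a <= t <= b -> clamp a b t = t.
Proof. by rewrite /clamp => /andP[? ?]; rewrite min_l// max_r. Qed.

Lemma measurable_clamp a b d (T : measurableType d) (A : set T) (f : T -> R) :
  measurable_fun A f -> measurable_fun A (clamp a b \o f).
Proof.
move=> mf.
rewrite (_ : _ \o _ = (cst a \max (f \min cst b))%O)//.
apply: measurable_maxr; first exact: measurable_cst.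
by apply: measurable_minr => //; exact: measurable_cst.
Qed.

End clamp.

Section limn_einf.
Context (R : realType).
Implicit Types u v : (\bar R)^nat.

Lemma limn_einfE u : limn_einf u = ereal_sup (range (einfs u)).
Proof. by rewrite limn_einf_lim; apply: cvg_lim => //; exact: cvg_einfs_sup. Qed.

Lemma limn_einf_lt u (W : \bar R) n : (limn_einf u < W)%E ->
  exists2 k, (n <= k)%N & (u k < W)%E.
Proof.
move=> uW; have : (einfs u n < W)%E.
  by rewrite (le_lt_trans _ uW)// limn_einfE; apply: ereal_sup_ubound; exists n.
by move=> /ereal_inf_lt[_ [k nk <-]] ?; exists k.
Qed.

Lemma limn_einf_le u (W : R) :
  (forall n e, 0 < e -> exists2 k, (n <= k)%N & (u k <= (W + e)%:E)%E) ->
  (limn_einf u <= W%:E)%E.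
Proof.
move=> uW; rewrite limn_einfE; apply: ge_ereal_sup => _ [n _ <-].
apply/lee_addgt0Pr => e e0; have [k nk uk] := uW n e e0.
by rewrite -EFinD (le_trans _ uk)//; apply: ereal_inf_lbound; exists k.
Qed.

Lemma le_limn_einf u v : (forall n, u n <= v n)%E ->
  (limn_einf u <= limn_einf v)%E.
Proof.
move=> uv; rewrite !limn_einfE; apply: ge_ereal_sup => _ [n _ <-].
apply: le_ereal_sup_tmp; exists (einfs v n); first by exists n.
apply: le_ereal_inf_tmp => _ [k nk <-]; apply: ge_ereal_inf.
by exists (u k) => //; exists k.
Qed.

End limn_einf.

Section L1dist.
Context d (T : measurableType d) (R : realType).
Implicit Types (nu : {measure set T -> \bar R}) (A B : set T) (f g h : T -> R).

Lemma ge0_integral_setU_le nu A B (f : T -> \bar R) :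
  measurable A -> measurable B -> measurable_fun (A `|` B) f ->
  (forall x, (0 <= f x)%E) ->
  (\int[nu]_(x in A `|` B) f x <= \int[nu]_(x in A) f x + \int[nu]_(x in B) f x)%E.
Proof.
move=> mA mB mf f0.
have mBA : measurable (B `\` A) by exact: measurableD.
have ABE : A `|` B = A `|` (B `\` A) by rewrite setDE setUIr setUCr setIT.
rewrite ABE ge0_integral_setU//; last 2 first.
- by rewrite -ABE.
- by apply/disj_setPS => x [Ax [_ nAx]]; exact: nAx.
apply: leeD => //; apply: ge0_subset_integral => //.
by apply: measurable_funS mf => //; exact: measurableU.
Qed.

Definition L1dist nu A f g : \bar R := (\int[nu]_(x in A) `|f x - g x|%:E)%E.

Lemma measurable_dist A f g : measurable_fun A f -> measurable_fun A g ->
  measurable_fun A (fun x => `|f x - g x|%:E : \bar R).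
Proof.
move=> mf mg; apply/measurable_EFinP; apply: measurableT_comp => //.
exact: measurable_funB.
Qed.

Lemma L1dist_ge0 nu A f g : (0 <= L1dist nu A f g)%E.
Proof. by apply: integral_ge0 => x _; rewrite lee_fin. Qed.

Lemma L1distC nu A f g : L1dist nu A f g = L1dist nu A g f.
Proof. by apply: eq_integral => x _; rewrite distrC. Qed.

(** The common source of the triangle inequality and of convexity. *)
Lemma L1dist_comb nu A f f' g g' h h' (a b : R) : measurable A ->
  measurable_fun A f -> measurable_fun A g -> measurable_fun A h ->
  measurable_fun A f' -> measurable_fun A g' -> measurable_fun A h' ->
  0 <= a -> 0 <= b ->
  (forall x, A x ->
    `|h x - h' x| <= a * `|f x - f' x| + b * `|g x - g' x|) ->
  (L1dist nu A h h' <= a%:E * L1dist nu A f f' + b%:E * L1dist nu A g g')%E.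
Proof.
move=> mA mf mg mh mf' mg' mh' a0 b0 hfg.
rewrite /L1dist.
rewrite -ge0_integralZl_EFin//; last exact: measurable_dist.
rewrite -ge0_integralZl_EFin//; last exact: measurable_dist.
rewrite -ge0_integralD//.
- apply: ge0_le_integral => //.
  + exact: measurable_dist.
  + apply: emeasurable_funD; apply: measurable_funeM; exact: measurable_dist.
- by move=> x _; rewrite -EFinM lee_fin mulr_ge0.
- apply: measurable_funeM; exact: measurable_dist.
- by move=> x _; rewrite -EFinM lee_fin mulr_ge0.
- apply: measurable_funeM; exact: measurable_dist.
Qed.

Lemma L1dist_triangle nu A f g h : measurable A ->
  measurable_fun A f -> measurable_fun A g -> measurable_fun A h ->
  (L1dist nu A f h <= L1dist nu A f g + L1dist nu A g h)%E.
Proof.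
move=> mA mf mg mh.
rewrite -(mul1e (L1dist nu A f g)) -(mul1e (L1dist nu A g h)).
apply: L1dist_comb => // x Ax.
by rewrite !mul1r (le_trans _ (ler_normD _ _))// addrA subrK.
Qed.

Lemma L1dist_le nu A f f' h h' : measurable A ->
  measurable_fun A f -> measurable_fun A h ->
  measurable_fun A f' -> measurable_fun A h' ->
  (forall x, A x -> `|h x - h' x| <= `|f x - f' x|) ->
  (L1dist nu A h h' <= L1dist nu A f f')%E.
Proof.
move=> mA mf mh mf' mh' hf; apply: ge0_le_integral => //.
- exact: measurable_dist.
- exact: measurable_dist.
Qed.

Lemma L1dist_le_cst nu A f g (c : R) : measurable A ->
  measurable_fun A f -> measurable_fun A g ->
  (forall x, A x -> `|f x - g x| <= c) ->
  (L1dist nu A f g <= c%:E * nu A)%E.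
Proof.
move=> mA mf mg fgc; rewrite -integral_cst//; apply: ge0_le_integral => //.
- exact: measurable_dist.
Qed.

End L1dist.

(** * Total variation as a relaxation in L^1 of a finite measure *)

Section relaxation.
Context (R : realType) (d : measure_display) (X : completeMetricBorelType R d).
Implicit Types (mu nu : {measure set X -> \bar R}) (f g u v : X -> R) (A U : set X).

(** A point y lies in some ball of radius 1/(k+1), centred at a point p of the
    dense set, that is contained in U y. One x with the ball contained in U x is
    chosen for each such pair (p, k), and U x then contains y. *)
Lemma separable_lindelof : separable X -> forall U : X -> set X,
  (forall x, open (U x) /\ U x x) ->
  exists s : nat -> X, \bigcup_i U (s i) = setT.
Proof.
move=> [D /countable_injP[i i_inj] dD] U oU.
pose Q (k : nat * nat) := [set x : X | exists p : X, [/\ D p, i p = k.1 &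
  ball p k.2.+1%:R^-1 `<=` U x]].
pose s n := xget point (Q (odflt (0, 0)%N (unpickle n))).
exists s; apply/seteqP; split => // y _.
have [oUy Uy] := oU y.
have /nbhs_ballP[e /= e0 eU] : nbhs y (U y) by apply: open_nbhs_nbhs.
have e20 : 0 < e / 2 by rewrite divr_gt0.
have [k _ /(_ _ (leqnn _)) /= ke] := near_infty_natSinv_lt (PosNum e20).
have [p [yp Dp]] : ball y k.+1%:R^-1 `&` D !=set0.
  apply: dD; last exact: open_ballX.
  by exists y; rewrite ballEmdist/= mdistxx invr_gt0.
exists (pickle (i p, k)) => //; rewrite /s pickleK /=.
case: xgetP => [x _ [q [Dq /= ipq qU]]|/(_ y) /= []]; last first.
  exists p; split => // z pz; apply: eU.
  apply: (@le_ball _ _ _ (k.+1%:R^-1 + k.+1%:R^-1)).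
    by rewrite [leRHS]splitr lerD// ltW.
  exact: ball_triangle pz.
have qp : q = p by apply: i_inj; rewrite ?inE.
by apply: qU; rewrite qp; apply: ball_sym.
Qed.

Definition bounded_measurable u :=
  measurable_fun setT u /\ exists M, forall x, `|u x| <= M.

Definition energy mu A f : \bar R := (\int[mu]_(x in A) slope f x)%E.

Lemma bounded_integrable mu A u : finite_on_bounded mu -> measurable A ->
  bounded_measurable u -> forall n, mu.-integrable (A `&` ball point n%:R) (EFin \o u).
Proof.
move=> finm mA [mfu [M uM]] n.
have mAB : measurable (A `&` ball (point : X) n%:R).
  by apply: measurableI => //; exact: measurable_ballX.
apply: measurable_bounded_integrable => //.
- apply: finm => //; exists point, n%:R; exact: subIsetr.
- exact: measurable_funTS.
- exists M; split; first exact: num_real.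
  by move=> r Mr x _ /=; rewrite (le_trans (uM x))// ltW.
Qed.

(** Convergence in L^1(nu) implies convergence in L^1 of mu on each ball, because
    nu is bounded below there by a multiple of mu. *)
Lemma tvar_open_le mu nu A u (W : R) : finite_on_bounded mu -> finite_weight mu nu ->
  open A -> bounded_measurable u ->
  (forall e, 0 < e -> exists f, [/\ locally_lipschitz A f,
     (energy mu A f <= (W + e)%:E)%E & (L1dist nu A f u <= e%:E)%E]) ->
  (tvar_open mu u A <= W%:E)%E.
Proof.
move=> finm [nufin num nuB] oA bu fP.
have mA : measurable A by exact: open_borel.
have mfuA : measurable_fun A u by apply: measurable_funTS; case: bu.
have : forall n : nat, exists f, [/\ locally_lipschitz A f,
     (energy mu A f <= (W + n.+1%:R^-1)%:E)%E &
     (L1dist nu A f u <= n.+1%:R^-1%:E)%E].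
  by move=> n; apply: fP; rewrite invr_gt0.
move=> /choice[f fE].
have lf n : locally_lipschitz A (f n) by case: (fE n).
have mf n : measurable_fun A (f n) by exact: measurable_locally_lipschitz.
have cvf : L1loc_cvg mu A f u.
  move=> x.
  have [n xn] : exists n : nat, mdist (point : X) x < n%:R.
    exists (Num.bound (mdist (point : X) x)).
    by apply: archi_boundP; exact: mdist_ge0.
  have [c c0 cnu] := nuB n.
  set U := ball point n%:R in cnu *.
  have mU : measurable U by exact: measurable_ballX.
  have mAU : measurable (A `&` U) by exact: measurableI.
  have dfu k : (\int[mu]_(y in A `&` U) `|f k y - u y|%:E <=
                (c^-1 * k.+1%:R^-1)%:E)%E.
    rewrite EFinM -lee_pdivrMl ?invr_gt0// invrK.
    have [_ _] := fE k; apply: le_trans.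
    apply: integral_weight_ge => //; first exact: measurable_dist.
  have uAU : mu.-integrable (A `&` U) (EFin \o u) by exact: bounded_integrable.
  exists U; split => //.
  - exact: open_ballX.
  - by rewrite /U ballEmdist.
  - move=> k.
    rewrite (_ : EFin \o _ =
      ((EFin \o (fun y => (f k y - u y)%R)) \+ (EFin \o u))%E); last first.
      by apply/funext => y /=; rewrite -EFinD subrK.
    apply: integrableD => //; apply/integrableP; split.
      apply/measurable_EFinP; apply: measurable_funB;
        [apply: measurable_funS (mf k)|apply: measurable_funS mfuA] => //.
    by rewrite (le_lt_trans (dfu k))// ltry.
  - apply: (@squeeze_cvge _ _ _ _ (cst 0%E) _ (fun k => (c^-1 * k.+1%:R^-1)%:E)).
    + near=> k; rewrite dfu andbT; apply: integral_ge0 => y _; by rewrite lee_fin.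
    + exact: cvg_cst.
    + rewrite -[0%E]/(0%:E) -(mulr0 c^-1); apply: cvg_EFin; first exact: nearW.
      apply: cvgMr; exact: cvg_harmonic.
apply: ge_ereal_inf; exists (limn_einf (fun n => \int[mu]_(x in A) slope (f n) x)%E).
  by exists f.
apply: limn_einf_le => n e e0.
have [k _ ke] := near_infty_natSinv_lt (PosNum e0).
exists (maxn n k); first exact: leq_maxl.
have [_ fW _] := fE (maxn n k); apply: (le_trans fW).
rewrite lee_fin lerD2l ltW//; apply: ke; exact: leq_maxr.
Unshelve. all: by end_near. Qed.

Lemma locally_lipschitz_clamp A f (a b : R) :
  locally_lipschitz A f -> locally_lipschitz A (clamp a b \o f).
Proof.
move=> lf; apply: (locally_lipschitz_comb (a := 1) (b := 0) _ _ lf lf) => // x y.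
by rewrite mul1r mul0r addr0 clamp_lip.
Qed.

Lemma slope_clamp A f (a b : R) x : locally_lipschitz A f -> A x ->
  (slope (clamp a b \o f) x <= slope f x)%E.
Proof.
move=> lf Ax; have fx := locally_lipschitz_slope lf Ax.
rewrite -[leRHS]adde0 -[X in (X + _)%E]mul1e -(mul0e (slope f x)).
apply: slope_le_comb => //; apply: nearW => y.
by rewrite mul1r mul0r addr0 clamp_lip.
Qed.

Lemma energy_clamp mu A f (a b : R) : open A -> locally_lipschitz A f ->
  (energy mu A (clamp a b \o f) <= energy mu A f)%E.
Proof.
move=> oA lf; have lcf := locally_lipschitz_clamp a b lf.
apply: ge0_le_integral => //.
- exact: open_borel.
- by move=> x _; exact: slope_ge0.
- exact: measurable_slope.
- exact: measurable_slope.
- by move=> x Ax; exact: slope_clamp Ax.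
Qed.

(** Conversely, let f n be a sequence from the definition of the variation, and
    take countably many neighbourhoods on which it converges to u in L^1.
    Finitely many of them cover X up to a set of small nu-measure, on which the
    truncations of the f n stay at bounded distance from u; on the others
    nu <= mu is used. Truncating does not increase the slope. *)
Lemma tvar_open_approx mu nu A u (W : R) : separable X ->
  finite_weight mu nu ->
  open A -> bounded_measurable u -> (tvar_open mu u A < W%:E)%E ->
  forall e, 0 < e -> exists f, [/\ locally_lipschitz A f,
     (energy mu A f <= W%:E)%E & (L1dist nu A f u <= e%:E)%E].
Proof.
move=> sepX [nufin num _] oA [mfu [M uM]] /ereal_inf_lt[_ [f [lf fu] <-]] fW e e0.
have mA : measurable A by exact: open_borel.
have mfuA : measurable_fun A u by exact: measurable_funTS.
have mf n : measurable_fun A (f n) by exact: measurable_locally_lipschitz.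
have M0 : 0 <= M by rewrite (le_trans _ (uM point)).
have [U UP] := choice fu.
have [|s sT] := separable_lindelof sepX (U := U).
  by move=> x; have [] := UP x.
pose V n := U (s n).
have oV n : open (V n) by have [] := UP (s n).
have mV n : measurable (V n) by exact: open_borel.
pose G N := \big[setU/set0]_(i < N) V i.
have mG N : measurable (G N) by exact: bigsetU_measurable.
pose g n y : \bar R := `|f n y - u y|%:E.
have mg n : measurable_fun A (g n) by exact: measurable_dist.
have g0 n y : (0 <= g n y)%E by rewrite lee_fin.
have gG N : forall e, 0 < e -> exists n0, forall n, (n0 <= n)%N ->
    (\int[mu]_(y in A `&` G N) g n y <= e%:E)%E.
  elim: N => [r r0|N IHN r r0].
    by exists 0%N => n _; rewrite /G big_ord0 setI0 integral_set0 lee_fin ltW.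
  have r20 : 0 < r / 2 by rewrite divr_gt0.
  have [n1 n1P] := IHN _ r20.
  have [_ _ _ _ /fine_cvgP[finV cvV]] := UP (s N).
  move/cvgr0Pnorm_le : cvV => /(_ _ r20)[n2 _ n2P].
  have [n3 _ n3P] := finV.
  exists (maxn n1 (maxn n2 n3)) => n; rewrite !geq_max => /and3P[n1n n2n n3n].
  rewrite /G big_ord_recr/= -/(G N) setIUr.
  apply: (le_trans (ge0_integral_setU_le _ _ _ _ _)) => //.
  - exact: measurableI.
  - exact: measurableI.
  - rewrite -setIUr; apply: measurable_funS (mg n) => //.
  rewrite [r in leRHS]splitr EFinD leeD//; first exact: n1P.
  have := n2P _ n2n => /=; rewrite ger0_norm; last first.
    by apply: fine_ge0; apply: integral_ge0.
  by rewrite -lee_fin fineK//; exact: n3P.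
have nuG : nu (~` G N) @[N --> \oo] --> 0%E.
  have -> : 0%E = nu (\bigcap_N ~` G N).
    rewrite -setC_bigcup (_ : \bigcup_N G N = setT) ?setCT ?measure0//.
    apply/seteqP; split => // y _.
    have [i _ iy] : (\bigcup_i U (s i)) y by rewrite sT.
    by exists i.+1 => //; rewrite /G -bigcup_mkord; exists i => /=.
  apply: nonincreasing_cvg_mu.
  - rewrite (le_lt_trans _ nufin)//; apply: le_measure; rewrite ?inE//.
    exact: measurableC.
  - by move=> N; exact: measurableC.
  - by apply: bigcap_measurable => // N _; exact: measurableC.
  - move=> N N' NN'; apply/subsetPset; apply: subsetC.
    exact: subset_bigsetU.
have [N nuN] : exists N, ((2 * M)%:E * nu (A `&` ~` G N) <= (e / 2)%:E)%E.
  have [M_0|MN0] := eqVneq M 0.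
    by exists 0%N; rewrite M_0 mulr0 mul0e lee_fin ltW// divr_gt0.
  have M2 : 0 < 2 * M by rewrite mulr_gt0// lt_neqAle eq_sym MN0.
  have eM : 0 < e / 2 / (2 * M) by rewrite !divr_gt0.
  move/fine_cvgP : nuG => [finG /cvgr0Pnorm_le /(_ _ eM) cvG].
  have [N _ /(_ _ (leqnn N)) [finN cvN]] := filterI finG cvG.
  exists N; apply: (@le_trans _ _ ((2 * M)%:E * nu (~` G N))%E).
    apply: lee_pmul => //; first by rewrite lee_fin ltW.
    apply: le_measure; rewrite ?inE//; last exact: measurableC.
    by apply: measurableI => //; exact: measurableC.
  rewrite -(fineK finN) -EFinM lee_fin mulrC -ler_pdivlMr//.
  by move: cvN; rewrite /= ger0_norm// fine_ge0.
have e20 : 0 < e / 2 by rewrite divr_gt0.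
have [n0 n0P] := gG N _ e20.
have [n n0n fn] := limn_einf_lt n0 fW.
pose h := clamp (- M) M \o f n.
have lh : locally_lipschitz A h by exact: locally_lipschitz_clamp.
have mh : measurable_fun A h by exact: measurable_locally_lipschitz.
exists h; split => //.
  by rewrite (le_trans (energy_clamp _ _ _ _ _))// ltW.
(* u is its own truncation, so the truncation of f n is not farther from u. *)
have uE y : u y = clamp (- M) M (u y).
  by rewrite clamp_id// -ler_norml.
have AE : A = (A `&` G N) `|` (A `&` ~` G N) by rewrite -setIUr setUCr setIT.
rewrite /L1dist [X in (\int[nu]_(x in X) _)%E]AE.
apply: (le_trans (ge0_integral_setU_le _ _ _ _ _)) => //.
- exact: measurableI.
- apply: measurableI => //; exact: measurableC.
- by rewrite -AE; exact: measurable_dist.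
rewrite [e in leRHS]splitr EFinD leeD//.
  apply: le_trans (n0P _ n0n).
  have mAG : measurable (A `&` G N) by exact: measurableI.
  apply: (@le_trans _ _ (\int[nu]_(y in A `&` G N) g n y)%E).
    apply: L1dist_le => //.
    - by apply: measurable_funS (mf n).
    - by apply: measurable_funS mh.
    - by apply: measurable_funS mfuA.
    - by apply: measurable_funS mfuA.
    by move=> y _; rewrite [u y in leLHS]uE clamp_lip.
  apply: integral_weight_le => //.
  by apply: measurable_funS (mg n).
apply: le_trans nuN; apply: L1dist_le_cst.
- by apply: measurableI => //; exact: measurableC.
- by apply: measurable_funS mh.
- by apply: measurable_funS mfuA.
move=> y _; rewrite (le_trans (ler_normB _ _))// mulrDl mul1r lerD//.
by apply: clamp_bound; rewrite ?normrN ger0_norm.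
Qed.

End relaxation.

(** * Semicontinuity, convexity and superadditivity of the total variation *)

Section bounded_measurable.
Context (R : realType) (d : measure_display) (X : completeMetricBorelType R d).
Implicit Types (f g u v : X -> R).

Lemma bounded_measurable_clamp (a b : R) u :
  measurable_fun setT u -> bounded_measurable (clamp a b \o u).
Proof.
move=> mfu; split; first exact: measurable_clamp.
exists (Num.max `|a| `|b|) => x; apply: clamp_bound.
  by rewrite le_max lexx.
by rewrite le_max lexx orbT.
Qed.

Lemma bounded_measurable_comb (a b c : R) u v :
  bounded_measurable u -> bounded_measurable v ->
  bounded_measurable (fun x => a * u x + b * v x + c).
Proof.
move=> [mfu [M uM]] [mv [N vN]]; split.
  apply: measurable_funD; last exact: measurable_cst.
  apply: measurable_funD; apply: measurable_funM => //; exact: measurable_cst.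
exists (`|a| * M + `|b| * N + `|c|) => x.
rewrite (le_trans (ler_normD _ _))// lerD2r (le_trans (ler_normD _ _))//.
by rewrite !normrM lerD// ler_wpM2l.
Qed.

Lemma bounded_measurable_indic (E : set X) : measurable E ->
  bounded_measurable (\1_E : X -> R).
Proof.
move=> mE; split; first exact: measurable_indic.
by exists 1 => x; rewrite indicE; case: (_ \in _); rewrite ?normr1 ?normr0.
Qed.

End bounded_measurable.

Section variation.
Context (R : realType) (d : measure_display) (X : completeMetricBorelType R d).
Context (mu nu : {measure set X -> \bar R}) (A : set X).
Context (sepX : separable X) (finm : finite_on_bounded mu).
Context (wnu : finite_weight mu nu) (oA : open A).
Implicit Types (f g u v : X -> R).

Local Notation V u := (tvar_open mu u A).

Let mA : measurable A. Proof. exact: open_borel. Qed.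

Let mfunA u : bounded_measurable u -> measurable_fun A u.
Proof. by case=> mfu _; exact: measurable_funTS. Qed.

Lemma tvar_open_ge0 u : (0 <= V u)%E.
Proof.
apply: le_ereal_inf_tmp => _ [f _ <-]; rewrite limn_einfE.
apply: le_ereal_sup_tmp; exists (einfs (fun n => \int[mu]_(x in A) slope (f n) x)%E 0).
  by exists 0%N.
apply: le_ereal_inf_tmp => _ [n _ <-]; apply: integral_ge0 => x _; exact: slope_ge0.
Qed.

Lemma tvar_open_leP u (W : R) : bounded_measurable u ->
  (V u <= W%:E)%E <->
  (forall e, 0 < e -> exists f, [/\ locally_lipschitz A f,
     (energy mu A f <= (W + e)%:E)%E & (L1dist nu A f u <= e%:E)%E]).
Proof.
move=> bu; split=> [VW e e0|]; last exact: tvar_open_le.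
apply: (tvar_open_approx sepX wnu) => //.
by rewrite (le_lt_trans VW)// lte_fin ltrDl.
Qed.

(** Approximations of the approximations v of u are approximations of u. *)
Lemma tvar_open_lsc u (W : R) : bounded_measurable u ->
  (forall e, 0 < e -> exists v, [/\ bounded_measurable v,
     (V v <= (W + e)%:E)%E & (L1dist nu A v u <= e%:E)%E]) ->
  (V u <= W%:E)%E.
Proof.
move=> bu uP; apply/tvar_open_leP => // e e0.
have e20 : 0 < e / 2 by rewrite divr_gt0.
have [v [bv Vv vu]] := uP _ e20.
have [f [lf fW fv]] := (tvar_open_leP _ bv).1 Vv _ e20.
exists f; split => //; first by rewrite -addrA -splitr in fW.
have mf : measurable_fun A f by exact: measurable_locally_lipschitz.
apply: (le_trans (L1dist_triangle _ mA mf (mfunA bv) (mfunA bu))).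
by rewrite [e in leRHS]splitr EFinD leeD.
Qed.

Lemma tvar_open_comb u v (a b c r s : R) : bounded_measurable u ->
  bounded_measurable v -> 0 <= a -> 0 <= b -> (V u <= r%:E)%E ->
  (V v <= s%:E)%E ->
  (V (fun x => a * u x + b * v x + c)%R <= (a * r + b * s)%:E)%E.
Proof.
move=> bu bv a0 b0 Vu Vv.
have bw := bounded_measurable_comb a b c bu bv.
apply/tvar_open_leP => // e e0.
have ab1 : 0 < a + b + 1 by rewrite ltr_wpDl// addr_ge0.
pose e' := e / (a + b + 1).
have e'0 : 0 < e' by rewrite divr_gt0.
have abe' : (a + b) * e' <= e.
  rewrite /e' mulrA ler_pdivrMr// mulrC; apply: ler_wpM2l; first exact: ltW.
  by rewrite lerDl.
have [f [lf fr fu]] := (tvar_open_leP _ bu).1 Vu _ e'0.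
have [g [lg gs gv]] := (tvar_open_leP _ bv).1 Vv _ e'0.
pose h x := a * f x + b * g x + c.
have hfg x y : `|h y - h x| <= a * `|f y - f x| + b * `|g y - g x|.
  have -> : h y - h x = a * (f y - f x) + b * (g y - g x) by rewrite /h; ring.
  by rewrite (le_trans (ler_normD _ _))// !normrM (ger0_norm a0) (ger0_norm b0).
have lh : locally_lipschitz A h by exact: (locally_lipschitz_comb a0 b0 lf lg hfg).
have mf : measurable_fun A f by exact: measurable_locally_lipschitz.
have mg : measurable_fun A g by exact: measurable_locally_lipschitz.
have mh : measurable_fun A h by exact: measurable_locally_lipschitz.
exists h; split => //.
- apply: (@le_trans _ _ (a%:E * energy mu A f + b%:E * energy mu A g)%E).
    rewrite /energy -ge0_integralZl_EFin//; last 2 first.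
    + by move=> x _; exact: slope_ge0.
    + exact: measurable_slope.
    rewrite -ge0_integralZl_EFin//; last 2 first.
    + by move=> x _; exact: slope_ge0.
    + exact: measurable_slope.
    rewrite -ge0_integralD//; last 4 first.
    + by move=> x _; rewrite mule_ge0// slope_ge0.
    + by apply: measurable_funeM; exact: measurable_slope.
    + by move=> x _; rewrite mule_ge0// slope_ge0.
    + by apply: measurable_funeM; exact: measurable_slope.
    apply: ge0_le_integral => //.
    + by move=> x _; exact: slope_ge0.
    + exact: measurable_slope.
    + by apply: emeasurable_funD; apply: measurable_funeM; exact: measurable_slope.
    + move=> x Ax; apply: slope_le_comb => //.
      * exact: (locally_lipschitz_slope lf).
      * exact: (locally_lipschitz_slope lg).
      * exact: nearW.
  apply: (@le_trans _ _ (a%:E * (r + e')%:E + b%:E * (s + e')%:E)%E).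
    by apply: leeD; apply: lee_wpmul2l.
  by rewrite -!EFinM -EFinD lee_fin; move: abe'; rewrite !mulrDr mulrDl; lra.
- apply: (@le_trans _ _ (a%:E * L1dist nu A f u + b%:E * L1dist nu A g v)%E).
    apply: L1dist_comb => //; do ?exact: mfunA.
    move=> x _.
    have -> : h x - (a * u x + b * v x + c) = a * (f x - u x) + b * (g x - v x).
      by rewrite /h; ring.
    by rewrite (le_trans (ler_normD _ _))// !normrM (ger0_norm a0) (ger0_norm b0).
  apply: (@le_trans _ _ (a%:E * e'%:E + b%:E * e'%:E)%E).
    by apply: leeD; apply: lee_wpmul2l.
  by rewrite -!EFinM -EFinD lee_fin -mulrDl.
Qed.

(** By continuity, near x at most one of the two truncations is not constant. The
    gap between b - e and b + e is needed: at a point where f = b the slopes of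
    the truncations at b can add up to twice the slope of f. *)
Lemma slope_clampD f (a b c e : R) x : locally_lipschitz A f -> A x -> 0 < e ->
  (slope (clamp a (b - e) \o f) x + slope (clamp (b + e) c \o f) x <= slope f x)%E.
Proof.
move=> lf Ax e0; have fx := locally_lipschitz_slope lf Ax.
have cst0 g : (\forall y \near x, g y = g x) -> (slope g x <= 0)%E.
  move=> gx; rewrite -[0%E]add0e -[X in (X + _)%E](mul0e (slope f x)).
  rewrite -[X in (_ + X)%E](mul0e (slope f x)); apply: slope_le_comb => //.
  by apply: filterS gx => y ->; rewrite subrr normr0 !mul0r addr0.
have fe := locally_lipschitz_near lf Ax e0.
have [fb|bf] := leP (f x) b.
  rewrite -[leRHS]adde0; apply: leeD; [exact: slope_clamp Ax|apply: cst0].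
  apply: filterS fe => y; rewrite ltr_norml => /andP[fy1 fy2] /=.
  have Hc z : f z <= b + e -> clamp (b + e) c (f z) = b + e.
    by move=> fz; rewrite /clamp max_l// ge_min fz.
  by rewrite !Hc//; lra.
rewrite -[leRHS]add0e; apply: leeD; [apply: cst0|exact: slope_clamp Ax].
apply: filterS fe => y; rewrite ltr_norml => /andP[fy1 fy2] /=.
have Hc z : b - e <= f z -> clamp a (b - e) (f z) = Num.max a (b - e).
  by move=> fz; rewrite /clamp min_r.
by rewrite !Hc//; lra.
Qed.

Lemma clamp_param_lip (a b a' b' t e : R) : `|a - a'| <= e -> `|b - b'| <= e ->
  `|clamp a b t - clamp a' b' t| <= e.
Proof.
rewrite !ler_norml => /andP[? ?] /andP[? ?]; apply/andP.
rewrite /clamp; repeat (match goal with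
  | |- context [Order.min ?x ?y] => case: (leP x y) => ?
  | |- context [Order.max ?x ?y] => case: (leP x y) => ? end).
all: split; lra.
Qed.

(** Lower semicontinuity in the form that adds up: lower bounds of the variations
    of finitely many functions hold for all close approximations at once. *)
Lemma tvar_open_lower u (p : R) : bounded_measurable u -> (p%:E < V u)%E ->
  exists2 e, 0 < e & forall f, locally_lipschitz A f ->
    (L1dist nu A f u <= e%:E)%E -> (p%:E < energy mu A f)%E.
Proof.
move=> bu pu; apply: contrapT => H; move: pu; rewrite ltNge => /negP; apply.
apply/tvar_open_leP => // e e0; apply: contrapT => nf; apply: H.
exists e => // f lf fu; rewrite ltNge; apply/negP => fp; apply: nf.
by exists f; split => //; rewrite (le_trans fp)// lee_fin lerDl ltW.
Qed.

(** Truncating one approximation f of u at b - del and b + del yields close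
    approximations of both truncations of u, with total energy at most that
    of f; the gap is harmless since it changes f by at most del. *)
Lemma tvar_open_clampD u (a b c : R) : bounded_measurable u ->
  (V (clamp a b \o u) + V (clamp b c \o u) <= V u)%E.
Proof.
move=> bu; case VE : (V u) => [W| |]; last 2 first.
- by rewrite leey.
- by have := tvar_open_ge0 u; rewrite VE.
have b1 := bounded_measurable_clamp a b (proj1 bu).
have b2 := bounded_measurable_clamp b c (proj1 bu).
have pq p q : (p%:E < V (clamp a b \o u))%E -> (q%:E < V (clamp b c \o u))%E ->
    p + q <= W.
  move=> /(tvar_open_lower b1)[e1 e10 e1P] /(tvar_open_lower b2)[e2 e20 e2P].
  apply/ler_addgt0Pr => e e0.
  pose K := fine (nu setT) + 1.
  have K0 : 0 < K by rewrite ltr_wpDl// fine_ge0.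
  have nuA : (nu A <= K%:E)%E.
    case: wnu => nufin _ _; apply: (@le_trans _ _ (nu setT)).
      by apply: le_measure; rewrite ?inE.
    by rewrite -[leLHS]fineK ?ge0_fin_numE// lee_fin lerDl.
  (* Half of e1 and e2 pays for the distance of f to u, half for the gap. *)
  pose e' := Num.min (e1 / 2) (e2 / 2).
  have e'0 : 0 < e' by rewrite lt_min !divr_gt0.
  pose del := e' / K.
  have del0 : 0 < del by rewrite divr_gt0.
  have [||f [lf fW fu]] := (tvar_open_leP W bu).1 _ (Num.min e e').
  - by rewrite VE.
  - by rewrite lt_min e0 e'0.
  have mf : measurable_fun A f by exact: measurable_locally_lipschitz.
  pose f1 := clamp a (b - del) \o f.
  pose f2 := clamp (b + del) c \o f.
  have lf1 : locally_lipschitz A f1 by exact: locally_lipschitz_clamp.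
  have lf2 : locally_lipschitz A f2 by exact: locally_lipschitz_clamp.
  have dist_clamp a1 b1' a2 b2' : `|a1 - a2| <= del -> `|b1' - b2'| <= del ->
      (L1dist nu A (clamp a1 b1' \o f) (clamp a2 b2' \o u) <= (e' + e')%:E)%E.
    move=> ha hb.
    have m1 : measurable_fun A (clamp a1 b1' \o f) by exact: measurable_clamp.
    have m2 : measurable_fun A (clamp a2 b2' \o f) by exact: measurable_clamp.
    have m3 : measurable_fun A (clamp a2 b2' \o u).
      by apply: measurable_clamp; exact: mfunA.
    apply: (le_trans (L1dist_triangle nu mA m1 m2 m3)); rewrite EFinD; apply: leeD.
      apply: (@le_trans _ _ (del%:E * nu A)%E).
        by apply: L1dist_le_cst => // x _; apply: clamp_param_lip.
      apply: (@le_trans _ _ (del%:E * K%:E)%E).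
        by apply: lee_wpmul2l => //; rewrite lee_fin ltW.
      by rewrite -EFinM lee_fin /del divfK// gt_eqF.
    apply: (@le_trans _ _ (L1dist nu A f u)).
      apply: L1dist_le => //; first exact: mfunA.
      by move=> x _; exact: clamp_lip.
    by rewrite (le_trans fu)// lee_fin ge_min lexx orbT.
  have p1 : (p%:E < energy mu A f1)%E.
    apply: e1P => //; apply: (le_trans (dist_clamp _ _ _ _ _ _)).
    - by rewrite subrr normr0 ltW.
    - by rewrite addrAC subrr add0r normrN ger0_norm// ltW.
    by rewrite lee_fin [leRHS]splitr lerD// /e' ge_min lexx.
  have p2 : (q%:E < energy mu A f2)%E.
    apply: e2P => //; apply: (le_trans (dist_clamp _ _ _ _ _ _)).
    - by rewrite addrAC subrr add0r ger0_norm// ltW.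
    - by rewrite subrr normr0 ltW.
    by rewrite lee_fin [leRHS]splitr lerD// /e' ge_min lexx orbT.
  rewrite -lee_fin EFinD (le_trans (leeD (ltW p1) (ltW p2)))//.
  rewrite /energy -ge0_integralD//; last 4 first.
  - by move=> x _; exact: slope_ge0.
  - exact: measurable_slope.
  - by move=> x _; exact: slope_ge0.
  - exact: measurable_slope.
  apply: (@le_trans _ _ (energy mu A f)).
    apply: ge0_le_integral => //.
    - by move=> x _; rewrite adde_ge0// slope_ge0.
    - by apply: emeasurable_funD; exact: measurable_slope.
    - exact: measurable_slope.
    - by move=> x Ax; exact: slope_clampD.
  by rewrite (le_trans fW)// lee_fin lerD2l ge_min lexx.
have := tvar_open_ge0 (clamp a b \o u); have := tvar_open_ge0 (clamp b c \o u).
move: pq.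
have N10 x : (0 <= x)%E -> ((-1)%:E < x :> \bar R)%E.
  by move=> x0; rewrite (lt_le_trans _ x0)// lte_fin ltrN10.
case: (V (clamp a b \o u)) => [P| |//]; case: (V (clamp b c \o u)) => [Q| |//] pq Q0 P0.
- rewrite -EFinD lee_fin; apply/ler_addgt0Pr => e e0.
  have e20 : 0 < e / 2 by rewrite divr_gt0.
  have := pq (P - e / 2) (Q - e / 2); rewrite !lte_fin !gtrBl => /(_ e20 e20).
  by rewrite -lerBlDr [e in leLHS]splitr; lra.
- have H : -1 + (W + 2) <= W by apply: pq; [exact: N10|exact: ltry].
  by exfalso; clear P0 Q0 pq N10 VE; lra.
- have H : W + 2 + -1 <= W by apply: pq; [exact: ltry|exact: N10].
  by exfalso; clear P0 Q0 pq N10 VE; lra.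
- have H : W + 2 + -1 <= W by apply: pq; [exact: ltry|exact: N10].
  by exfalso; clear P0 Q0 pq N10 VE; lra.
Qed.

Lemma tvar_open_clamp u (a b : R) : bounded_measurable u ->
  (V (clamp a b \o u) <= V u)%E.
Proof.
move=> bu; rewrite (le_trans _ (tvar_open_clampD a b b bu))//.
by rewrite leeDl// tvar_open_ge0.
Qed.

End variation.

(** * Coarea inequality *)

Lemma clamp_comp (R : realType) (a b c e t : R) : a <= c -> c <= e -> e <= b ->
  clamp c e (clamp a b t) = clamp c e t.
Proof.
move=> ac ce eb; have cb := le_trans ce eb; have ab := le_trans ac cb.
rewrite /clamp; case: (leP t b) => tb.
  case: (leP a t) => // ta.
  rewrite (min_l (le_trans ac ce)) (max_l ac) min_l ?max_l//.
    exact: ltW (lt_le_trans ta ac).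
  by rewrite (le_trans (ltW ta))// (le_trans ac).
by rewrite (max_r ab) (min_r eb) (min_r (le_trans eb (ltW tb))).
Qed.

(** Continuous induction. The first step leaves a surplus eta over K h. The x with
    w a x >= K (x - a) + eta have a supremum s, which satisfies the same
    inequality since w a is nondecreasing; a further step from s would
    contradict the choice of s unless s = b. *)
Lemma superadditive_growth (R : realType) (a b K : R) (w : R -> R -> R) :
  a < b -> 0 <= K ->
  (forall x y, a <= x -> x <= y -> y <= b -> 0 <= w x y) ->
  (forall x y, a <= x -> x <= y -> y <= b -> w a x + w x y <= w a y) ->
  (forall t, a <= t -> t < b ->
    exists h, [/\ 0 < h, h <= b - t & K * h < w t (t + h)]) ->
  K * (b - a) < w a b.
Proof.
move=> ab K0 w0 super step.
have p_nd x y : a <= x -> x <= y -> y <= b -> w a x <= w a y.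
  by move=> ax xy yb; rewrite (le_trans _ (super x y ax xy yb))// lerDl w0.
have [h0 [h00 h0b h0K]] := step a (lexx a) ab.
have ah0b : a + h0 <= b by rewrite -lerBrDl.
(* The surplus of the first step turns the final inequality into a strict one. *)
pose eta := w a (a + h0) - K * h0.
have eta0 : 0 < eta by rewrite subr_gt0.
pose S := [set x | [/\ a <= x, x <= b & K * (x - a) + eta <= w a x]].
have Sah0 : S (a + h0).
  split => //; first by rewrite lerDl ltW.
  by rewrite /eta addrAC subrr add0r addrC subrK.
have supS : has_sup S.
  by split; [exists (a + h0)|exists b => x []].
have ubS x : S x -> x <= sup S by apply: ub_le_sup; case: supS.
have sb : sup S <= b by apply: ge_sup; [exists (a + h0)|move=> x []].
have as_ : a <= sup S.
  by rewrite (le_trans _ (ubS _ Sah0))// lerDl ltW.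
have {}supS e : 0 < e -> exists2 x, S x & sup S - e < x.
  by move=> e0; exact: sup_adherent.
move: (sup S) ubS sb as_ supS => s ubS sb as_ supS.
have Ks : K * (s - a) + eta <= w a s.
  apply/ler_addgt0Pr => e e0.
  have K1 : 0 < K + 1 by rewrite ltr_wpDl.
  have [x [ax xb xK] sx] := supS _ (divr_gt0 e0 K1).
  have xs : x <= s by exact: ubS.
  have xsw := p_nd x s ax xs sb.
  have H1 : K * (s - e / (K + 1)) <= K * x by apply: ler_wpM2l => //; exact: ltW.
  have H2 : K * (e / (K + 1)) <= e.
    rewrite mulrCA -[leRHS]mulr1; apply: ler_wpM2l; first exact: ltW.
    by rewrite ler_pdivrMr// mul1r lerDl.
  rewrite mulrBr in H1; rewrite mulrBr in xK; rewrite mulrBr.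
  move: H1 H2 xK xsw; move: (K * s) (K * a) (K * x) (K * (e / _)) (w a x) (w a s).
  move=> ? ? ? ? ? ?; lra.
have [sltb|bs] := ltP s b; last first.
  have sE : s = b by apply/eqP; rewrite eq_le sb bs.
  by rewrite sE in Ks; rewrite (lt_le_trans _ Ks)// ltrDl.
have [h [h_gt0 hb hK]] := step s as_ sltb.
have shb : s + h <= b by rewrite -lerBrDl.
have ssh : s <= s + h by rewrite lerDl ltW.
have : s + h <= s.
  apply: ubS; split => //; first exact: (le_trans as_).
  rewrite (le_trans _ (super s (s + h) as_ ssh shb))//.
  have -> : K * (s + h - a) = K * (s - a) + K * h by ring.
  by rewrite addrAC lerD// ltW.
by rewrite gerDl leNgt h_gt0.
Qed.

Lemma indic_predE (R : realType) (T : Type) (P : pred T) (x : T) :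
  \1_[set y | P y] x = (P x)%:R :> R.
Proof. by rewrite indicE; congr (_ %:R); congr nat_of_bool; apply/idP/idP; rewrite inE. Qed.

Section coarea.
Context (R : realType) (d : measure_display) (X : completeMetricBorelType R d).
Context (mu nu : {measure set X -> \bar R}) (A : set X).
Context (sepX : separable X) (finm : finite_on_bounded mu).
Context (wnu : finite_weight mu nu) (oA : open A).
Implicit Types (f g u v : X -> R).

Local Notation V u := (tvar_open mu u A).

Lemma L1dist_le_indic f g (F : set X) : measurable_fun A f -> measurable_fun A g ->
  measurable F -> (forall x, `|f x - g x| <= \1_F x) ->
  (L1dist nu A f g <= nu F)%E.
Proof.
move=> mf mg mF fgF; have mA : measurable A by exact: open_borel.
apply: (@le_trans _ _ (\int[nu]_(x in A) (\1_F x)%:E)%E).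
  apply: ge0_le_integral => //.
  - exact: measurable_dist.
  - by apply/measurable_EFinP; exact: measurable_indic.
  - by move=> x _; rewrite lee_fin.
rewrite integral_indic//; apply: le_measure; rewrite ?inE//.
exact: measurableI.
Qed.

Lemma measurable_superlevel u (t : R) : measurable_fun setT u ->
  measurable [set x | t < u x].
Proof.
move=> mfu; rewrite (_ : [set _ | _] = setT `&` u @^-1` `]t, +oo[).
  exact: mfu.
by rewrite setTI; apply/seteqP; split => x /=; rewrite in_itv/= andbT.
Qed.

(** The slabs exclude the level t, so they decrease to the empty set even when
    {u = t} has positive measure. This is why superlevel sets are approached
    from above. *)
Lemma nu_slab_small u (t e : R) : measurable_fun setT u -> 0 < e ->
  exists2 h, 0 < h & forall h', h' <= h ->
    (nu [set x | (t < u x < t + h')%R] <= e%:E)%E.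
Proof.
move=> mfu e0.
have mF h : measurable [set x | t < u x < t + h].
  rewrite (_ : [set _ | _] = setT `&` u @^-1` `]t, (t + h)[); first exact: mfu.
  by rewrite setTI; apply/seteqP; split => x /=; rewrite in_itv/=.
pose F n := [set x : X | t < u x < t + n.+1%:R^-1].
have [nufin _ _] := wnu.
have : nu (F n) @[n --> \oo] --> 0%E.
  have -> : 0%E = nu (\bigcap_n F n).
    rewrite (_ : \bigcap_n F n = set0) ?measure0//.
    apply/seteqP; split => // x Fx.
    have /andP[tu _] := Fx 0%N I.
    have tu0 : 0 < u x - t by rewrite subr_gt0.
    have [k _ /(_ _ (leqnn _)) /= ks] := near_infty_natSinv_lt (PosNum tu0).
    by have /andP[_] := Fx k I; rewrite -ltrBlDl ltNge (ltW ks).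
  apply: nonincreasing_cvg_mu.
  - rewrite (le_lt_trans _ nufin)//; apply: le_measure; rewrite ?inE//; exact: mF.
  - by move=> n; exact: mF.
  - by apply: bigcap_measurable => // n _; exact: mF.
  - move=> n m nm; apply/subsetPset => x /andP[tu um]; apply/andP; split => //.
    by rewrite (lt_le_trans um)// lerD2l lef_pV2 ?posrE// ler_nat.
move=> /fine_cvgP[finF /cvgr0Pnorm_le /(_ _ e0) cvF].
have [n _ /(_ _ (leqnn n)) [finn cvn]] := filterI finF cvF.
exists n.+1%:R^-1; first by rewrite invr_gt0.
move=> h' hn; apply: (@le_trans _ _ (nu (F n))).
  apply: le_measure; [by rewrite inE; exact: mF|by rewrite inE; exact: mF|].
  move=> x /andP[tu uh]; apply/andP; split => //.
  by rewrite (lt_le_trans uh)// lerD2l.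
by rewrite -(fineK finn) lee_fin; move: cvn; rewrite /= ger0_norm// fine_ge0.
Qed.

(** The functions (clamp t (t + h) u - t) / h differ from the indicator of {u > t}
    only on the slab {t < u < t + h}, and their variation is 1/h times that of
    the truncation; let h tend to 0. *)
Lemma superlevel_clamp u (t K h0 : R) : bounded_measurable u -> 0 < h0 ->
  (K%:E < V \1_[set x | (t < u x)%R])%E ->
  exists h, [/\ 0 < h, h <= h0 & ((K * h)%:E < V (clamp t (t + h)%R \o u))%E].
Proof.
move=> bu h00 KV; apply: contrapT => nh; move: KV; rewrite ltNge => /negP; apply.
have mfu : measurable_fun setT u by case: bu.
have mE : measurable [set x | t < u x] by exact: measurable_superlevel.
apply: (tvar_open_lsc sepX finm wnu oA); first exact: bounded_measurable_indic.
move=> e e0; have [h1 h10 h1e] := nu_slab_small t mfu e0.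
pose h := Num.min h0 h1.
have h_gt0 : 0 < h by rewrite lt_min h00.
(* If no h <= h0 worked, the normalised truncations would have variation <= K. *)
have hV : (V (clamp t (t + h)%R \o u) <= (K * h)%:E)%E.
  rewrite leNgt; apply/negP => Vh; apply: nh; exists h; split => //.
  by rewrite /h ge_min lexx.
have bc := bounded_measurable_clamp t (t + h) mfu.
exists (fun x => h^-1 * (clamp t (t + h) \o u) x + 0 * (clamp t (t + h) \o u) x + (- t / h)).
have bv := bounded_measurable_comb h^-1 0 (- t / h) bc bc.
split => //.
  apply: (@le_trans _ _ (h^-1 * (K * h) + 0 * (K * h))%:E).
    by apply: (tvar_open_comb sepX finm wnu oA) => //; rewrite invr_ge0 ltW.
  by rewrite lee_fin mul0r addr0 mulrCA mulVf ?gt_eqF// mulr1 lerDl ltW.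
apply: le_trans (h1e h _); last by rewrite /h ge_min lexx orbT.
apply: L1dist_le_indic.
- by apply: measurable_funTS; case: bv.
- by apply: measurable_funTS; exact: measurable_indic.
- rewrite (_ : [set _ | _] = setT `&` u @^-1` `]t, (t + h)[); first exact: mfu.
  by rewrite setTI; apply/seteqP; split => x /=; rewrite in_itv/=.
move=> x; rewrite mul0r addr0 /=.
have -> : h^-1 * clamp t (t + h) (u x) + - t / h = (clamp t (t + h) (u x) - t) / h.
  by rewrite mulrBl mulrC mulNr.
rewrite (indic_predE _ (fun y => t < u y)) (indic_predE _ (fun y => t < u y < t + h)).
have [ut|tu] /= := leP (u x) t.
  have -> : clamp t (t + h) (u x) = t.
    by rewrite /clamp min_l ?max_l// (le_trans ut)// lerDl ltW.
  by rewrite subrr mul0r subr0 normr0.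
have [uh|hu] /= := ltP (u x) (t + h).
  rewrite clamp_id; last by rewrite !ltW.
  have -> : (u x - t) / h - 1 = - ((t + h - u x) / h).
    by field; rewrite gt_eqF.
  rewrite normrN ger0_norm ?divr_ge0 ?subr_ge0 ?(ltW uh) ?(ltW h_gt0)//.
  by rewrite ler_pdivrMr// mul1r; lra.
have -> : clamp t (t + h) (u x) = t + h.
  by rewrite /clamp min_r// max_r ?lerDl ?ltW.
by rewrite addrAC subrr add0r divff ?gt_eqF// subrr normr0.
Qed.

Lemma tvar_open_clamp_super u (a x y : R) : measurable_fun setT u ->
  a <= x -> x <= y ->
  (V (clamp a x \o u) + V (clamp x y \o u) <= V (clamp a y \o u))%E.
Proof.
move=> mfu ax xy.
have := tvar_open_clampD sepX finm wnu oA a x y (bounded_measurable_clamp a y mfu).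
rewrite (_ : clamp a x \o _ = clamp a x \o u); last first.
  by apply/funext => z /=; rewrite clamp_comp.
rewrite (_ : clamp x y \o _ = clamp x y \o u)//.
by apply/funext => z /=; rewrite clamp_comp.
Qed.

(** If no level were good, all perimeters would exceed K, the mean of the
    variation over [a, b], and superadditive growth would give more than K (b - a)
    for the total. *)
Lemma coarea_level u (a b : R) : bounded_measurable u -> a < b ->
  (V (clamp a b \o u) < +oo)%E ->
  exists t, [/\ a <= t, t < b &
    ((b - a)%:E * V \1_[set x | (t < u x)%R] <= V (clamp a b \o u))%E].
Proof.
move=> bu ab; have mfu : measurable_fun setT u by case: bu.
have [W [WE super W0]] : exists W : R -> R -> \bar R,
    [/\ forall x y, V (clamp x y \o u) = W x y,
        forall x y, a <= x -> x <= y -> (W a x + W x y <= W a y)%E &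
        forall x y, (0 <= W x y)%E].
  exists (fun x y => V (clamp x y \o u)); split => [//|x y ax xy|x y].
    exact: tvar_open_clamp_super.
  exact: tvar_open_ge0.
rewrite WE => Wfin; apply: contrapT => nt.
have Wfin1 x : a <= x -> x <= b -> W a x \is a fin_num.
  move=> ax xb; rewrite ge0_fin_numE// (le_lt_trans _ Wfin)//.
  by rewrite (le_trans _ (super x b ax xb))// leeDl.
have Wfin2 x y : a <= x -> x <= y -> y <= b -> W x y \is a fin_num.
  move=> ax xy yb; rewrite ge0_fin_numE//.
  rewrite (@le_lt_trans _ _ (W a y))//.
    by rewrite (le_trans _ (super x y ax xy))// leeDr.
  by rewrite -ge0_fin_numE// Wfin1// (le_trans ax).
have ba0 : 0 < b - a by rewrite subr_gt0.
pose K := fine (W a b) / (b - a).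
have : K * (b - a) < fine (W a b).
  apply: (superadditive_growth (w := fun x y => fine (W x y))) => //.
  - by rewrite divr_ge0 ?fine_ge0// ltW.
  - by move=> x y _ _ _; exact: fine_ge0.
  - move=> x y ax xy yb.
    rewrite -fineD ?Wfin1 ?Wfin2// ?(le_trans xy)//.
    apply: fine_le; rewrite ?fin_numD ?Wfin1 ?Wfin2// ?(le_trans xy)// ?(le_trans ax)//.
    exact: super.
  move=> t at_ tb; have tb0 : 0 < b - t by rewrite subr_gt0.
  have : (K%:E < V \1_[set x | (t < u x)%R])%E.
    rewrite ltNge; apply/negP => VK; apply: nt; exists t; split => //.
    apply: (@le_trans _ _ ((b - a)%:E * K%:E)%E).
      by apply: lee_wpmul2l => //; rewrite lee_fin ltW.
    by rewrite -EFinM /K mulrCA divff ?gt_eqF// mulr1 fineK// Wfin1// ltW.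
  move=> /(superlevel_clamp bu tb0)[h [h_gt0 htb hV]]; exists h; split => //.
  rewrite WE in hV; rewrite -lte_fin fineK// Wfin2//.
    by rewrite lerDl ltW.
  by rewrite -lerBrDl.
by rewrite /K divfK ?gt_eqF// ltxx.
Qed.

(** The truncations of u to the first n intervals of the grid of mesh h have
    variations adding up to at most that of u, by superadditivity. *)
Lemma coarea_levels u (h : R) : bounded_measurable u -> (forall x, 0 <= u x) ->
  0 < h -> (V u < +oo)%E ->
  exists t : nat -> R, (forall i, i%:R * h <= t i < i.+1%:R * h) /\
    (forall i, (V \1_[set x | (t i < u x)%R] < +oo)%E) /\
    forall n, (\sum_(i < n) h%:E * V \1_[set x | (t i < u x)%R] <= V u)%E.
Proof.
move=> bu u0 h0 Vu; have mfu : measurable_fun setT u by case: bu.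
have Vc a b : (V (clamp a b \o u) < +oo)%E.
  by rewrite (le_lt_trans _ Vu)//; exact: (tvar_open_clamp sepX finm wnu oA).
have : forall i : nat, exists t, i%:R * h <= t < i.+1%:R * h /\
    (h%:E * V \1_[set x | (t < u x)%R] <= V (clamp (i%:R * h) (i.+1%:R * h)%R \o u))%E.
  move=> i; have [||t [at_ tb]] := @coarea_level u (i%:R * h) (i.+1%:R * h) bu.
  - by rewrite ltr_pM2r// ltr_nat.
  - exact: Vc.
  rewrite -mulrBl -natrB// subSnn mul1r => tV.
  by exists t; split => //; rewrite at_.
move=> /choice[t tP]; exists t; split; first by move=> i; case: (tP i).
split.
  move=> i; have [_ ti] := tP i; rewrite ltey; apply/eqP => Vy.
  have := le_lt_trans ti (Vc _ _).
  by rewrite Vy gt0_muley ?lte_fin// ltxx.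
move=> n; apply: (@le_trans _ _ (V (clamp 0 (n%:R * h)%R \o u))).
  elim: n => [|n IHn]; first by rewrite big_ord0 tvar_open_ge0.
  rewrite big_ord_recr/=.
  have nh0 : 0 <= n%:R * h by rewrite mulr_ge0// ltW.
  have nhh : n%:R * h <= n.+1%:R * h by rewrite ler_pM2r// ler_nat.
  apply: le_trans (tvar_open_clamp_super mfu nh0 nhh).
  by apply: leeD => //; case: (tP n).
exact: (tvar_open_clamp sepX finm wnu oA).
Qed.

End coarea.

Section ae.
Context (R : realType) (d : measure_display) (X : completeMetricBorelType R d).
Implicit Types (mu : {measure set X -> \bar R}) (f g u v : X -> R) (A : set X).

(** Both the integrability of the limit and the distances to it only depend on its
    class. *)
Lemma L1loc_cvg_ae_eq mu A (f : (X -> R)^nat) u v : open A ->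
  (forall n, locally_lipschitz A (f n)) ->
  measurable_fun setT u -> measurable_fun setT v -> ae_eq mu A u v ->
  L1loc_cvg mu A f u -> L1loc_cvg mu A f v.
Proof.
move=> oA lf mfu mv uv fu x; have [U [oU Ux iu if_ cvu]] := fu x.
have mAU : measurable (A `&` U) by apply: measurableI; exact: open_borel.
have uvU : ae_eq mu (A `&` U) u v by apply: filterS uv => y uvy [/uvy].
exists U; split => //.
  apply/integrableP; split.
    by apply/measurable_EFinP; exact: measurable_funTS.
  have /integrableP[_] := iu; congr (_ < _)%E.
  apply: ge0_ae_eq_integral => //.
  - apply: measurableT_comp => //; apply/measurable_EFinP; exact: measurable_funTS.
  - apply: measurableT_comp => //; apply/measurable_EFinP; exact: measurable_funTS.
  - by apply: filterS uvU => y uvy Ay /=; rewrite uvy.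
rewrite (_ : (fun n => _) = (fun n => \int[mu]_(y in A `&` U) `|f n y - u y|%:E)%E)//.
apply/funext => n.
have mf : measurable_fun (A `&` U) (f n).
  by apply: measurable_funS (measurable_locally_lipschitz oA (lf n)) => //; exact: open_borel.
apply: ge0_ae_eq_integral => //.
- by apply: measurable_dist => //; exact: measurable_funTS.
- by apply: measurable_dist => //; exact: measurable_funTS.
- by apply: filterS uvU => y uvy Ay /=; rewrite uvy.
Qed.

Lemma tvar_open_ae_eq mu A u v : open A ->
  measurable_fun setT u -> measurable_fun setT v -> ae_eq mu A u v ->
  tvar_open mu u A = tvar_open mu v A.
Proof.
move=> oA mfu mv uv; rewrite /tvar_open; congr (ereal_inf (image _ _)).
apply/seteqP; split => f [lf fu]; split => //.
  exact: L1loc_cvg_ae_eq fu.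
apply: (L1loc_cvg_ae_eq oA lf mv mfu) fu => //.
by apply: filterS uv => y uvy Ay; rewrite uvy.
Qed.

End ae.

(** * Nested convex sets of functions in L^2 *)

Section fast_cauchy.
Context d (T : measurableType d) (R : realType).
Context (nu : {measure set T -> \bar R}) (nufin : (nu setT < +oo)%E).
Implicit Types (v w : T -> R) (K : nat -> set (T -> R)).

Definition unit_valued v := measurable_fun setT v /\ forall x, 0 <= v x <= 1.

(** The sum of the increments is integrable, hence finite almost everywhere, where
    v n x converges; all functions are bounded by 1, so dominated convergence
    applies. Truncating the limit makes it take values in [0, 1] everywhere. *)
Lemma fast_cauchy_cvg (v : (T -> R)^nat) (C : R) : 0 <= C ->
  (forall n, unit_valued (v n)) ->
  (forall n, (L1dist nu setT (v n) (v n.+1) <= (C / (2 ^ n.+1)%:R)%:E)%E) ->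
  exists v', unit_valued v' /\
    L1dist nu setT (v n) v' @[n --> \oo] --> 0%E.
Proof.
move=> C0 uv vC.
have mv n : measurable_fun setT (v n) by case: (uv n).
have v01 n x : 0 <= v n x <= 1 by case: (uv n) => _; exact.
pose g n x : \bar R := `|v n x - v n.+1 x|%:E.
have mg n : measurable_fun setT (g n) by exact: measurable_dist.
have g0 n x : (0 <= g n x)%E by rewrite lee_fin.
pose G x : \bar R := (\sum_(0 <= n <oo) g n x)%E.
have mG : measurable_fun setT G by apply: ge0_emeasurable_sum.
have G0 x : (0 <= G x)%E by apply: nneseries_ge0.
have Gfin : (\int[nu]_x G x < +oo)%E.
  rewrite /G integral_nneseries//.
  apply: (@le_lt_trans _ _ (\sum_(0 <= n <oo) (C / (2 ^ n.+1)%:R)%:E)%E).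
    by apply: lee_nneseries => // n _; [move=> _; exact: integral_ge0|exact: vC].
  by rewrite (le_lt_trans (epsilon_trick0 _ C0))// ltry.
have iG : nu.-integrable setT G.
  apply/integrableP; split => //.
  by under eq_integral do rewrite gee0_abs//.
have cvgv : {ae nu, forall x, cvgn (fun n => v n x)}.
  have := integrable_ae measurableT iG; apply: filterS => x /(_ I) Gx.
  pose u n := v n.+1 x - v n x.
  have cu : cvgn (series u).
    apply: normed_cvg; apply: nondecreasing_is_cvgn.
      by apply: nondecreasing_series => n _ _; exact: normr_ge0.
    exists (fine (G x)) => _ [n _ <-].
    rewrite -lee_fin fineK//.
    apply: (@le_trans _ _ (\sum_(0 <= k < n) g k x)%E).
      rewrite /series/= -sumEFin; apply: lee_sum => k _.
      by rewrite /g /u distrC.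
    by apply: nneseries_lim_ge.
  have -> : (fun n => v n x) = (fun n => v 0%N x + series u n).
    apply/funext => n; rewrite /u /series/= telescope_sumr//.
    by rewrite addrC subrK.
  by apply: is_cvgD => //; exact: is_cvg_cst.
pose w x := fine (limn_esup (fun n => (v n x)%:E)).
have mw : measurable_fun setT w.
  apply: measurableT_comp => //.
  by apply: measurable_fun_limn_esup => n; apply/measurable_EFinP.
exists (clamp 0 1 \o w); split.
  split; first exact: measurable_clamp.
  by move=> x; rewrite /= /clamp le_max lexx/= ge_max ler01 ge_min lexx orbT.
have mcw : measurable_fun setT (clamp 0 1 \o w) by exact: measurable_clamp.
have cvgw : {ae nu, forall x, v n x @[n --> \oo] --> (clamp 0 1 \o w) x}.
  apply: filterS cvgv => x cvx.
  have wE : w x = limn (fun n => v n x).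
    have cE : (v n x)%:E @[n --> \oo] --> (limn (fun n => v n x))%:E.
      by apply: cvg_EFin => //; exact: nearW.
    by rewrite /w (cvg_limn_einf_sup cE).2.
  have w01 : 0 <= w x <= 1.
    rewrite wE; apply/andP; split.
      by apply: limr_ge => //; apply: nearW => n; case/andP: (v01 n x).
    by apply: limr_le => //; apply: nearW => n; case/andP: (v01 n x).
  by rewrite /= clamp_id// wE.
have [| | | | | _ cv0 _] := @dominated_convergence _ _ _ nu setT measurableT
  (fun n x => `|v n x - (clamp 0 1 \o w) x|%:E) (cst 0%E) (cst 1%E).
- by move=> n; exact: measurable_dist.
- exact: measurable_cst.
- apply: filterS cvgw => x cvx _; apply: cvg_EFin; first exact: nearW.
  apply/cvgr0Pnorm_lt => e e0; move/cvgrPdist_lt : cvx => /(_ _ e0).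
  by apply: filterS => n; rewrite normr_id distrC.
- apply/integrableP; split => //.
  under eq_integral do rewrite /= normr1.
  by rewrite integral_cst// mul1e.
- apply: nearW => x n _; rewrite gee0_abs ?lee_fin//.
  have /andP[? ?] := v01 n x.
  have : 0 <= (clamp 0 1 \o w) x <= 1.
    by rewrite /= /clamp le_max lexx/= ge_max ler01 ge_min lexx orbT.
  by move=> /andP[? ?]; rewrite ler_norml; apply/andP; split; lra.
move: cv0; rewrite (_ : [sequence _]_n = (fun n => L1dist nu setT (v n) (clamp 0 1 \o w)))//.
apply/funext => n; apply: eq_integral => x _.
by rewrite /= subr0 normr_id.
Qed.

Definition L2sq v : \bar R := (\int[nu]_x ((v x) ^+ 2)%:E)%E.

Let msq v : measurable_fun setT v -> measurable_fun setT (fun x => ((v x) ^+ 2)%:E : \bar R).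
Proof. by move=> mv; apply/measurable_EFinP; exact: measurable_funX. Qed.

Lemma L2sq_ge0 v : (0 <= L2sq v)%E.
Proof. by apply: integral_ge0 => x _; rewrite lee_fin sqr_ge0. Qed.

Lemma L2sq_le v : unit_valued v -> (L2sq v <= nu setT)%E.
Proof.
move=> [mv v01]; rewrite -[leRHS]mul1e -integral_cst//.
apply: ge0_le_integral => //.
- by move=> x _; rewrite lee_fin sqr_ge0.
- exact: msq.
- by move=> x _; rewrite lee_fin; have /andP[? ?] := v01 x; rewrite exprn_ile1.
Qed.

Lemma L2sq_fin v : unit_valued v -> L2sq v \is a fin_num.
Proof.
move=> uv; rewrite ge0_fin_numE ?L2sq_ge0//.
exact: le_lt_trans (L2sq_le uv) nufin.
Qed.

Definition midpoint v w := fun x => (v x + w x) / 2.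

Lemma parallelogram v w : measurable_fun setT v -> measurable_fun setT w ->
  (L2sq (v \- w)%R + 4%:E * L2sq (midpoint v w) = 2%:E * L2sq v + 2%:E * L2sq w)%E.
Proof.
move=> mv mw.
have mm : measurable_fun setT (midpoint v w).
  by apply: measurable_funM; [exact: measurable_funD|exact: measurable_cst].
have md : measurable_fun setT (v \- w) by exact: measurable_funB.
have ge0 z : forall x, setT x -> (0 <= ((z x) ^+ 2)%:E :> \bar R)%E.
  by move=> x _; rewrite lee_fin sqr_ge0.
rewrite /L2sq -!ge0_integralZl_EFin//; do ?[exact: msq|exact: ge0].
rewrite -!ge0_integralD//; do ?[by move=> x _; rewrite lee_fin sqr_ge0
  |by move=> x _; rewrite -EFinM lee_fin; apply: mulr_ge0 => //; exact: sqr_ge0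
  |by apply: measurable_funeM; exact: msq|exact: msq].
apply: eq_integral => x _; rewrite -!EFinM -!EFinD; congr EFin.
by rewrite /midpoint /=; field.
Qed.

Lemma L1dist_L2sq v w (e : R) : 0 < e -> measurable_fun setT v -> measurable_fun setT w ->
  (L1dist nu setT v w <= e%:E * nu setT + e^-1%:E * L2sq (v \- w)%R)%E.
Proof.
move=> e0 mv mw; have md : measurable_fun setT (v \- w) by exact: measurable_funB.
rewrite -integral_cst// /L2sq -ge0_integralZl_EFin//; last 3 first.
- by move=> x _; rewrite lee_fin sqr_ge0.
- exact: msq.
- by rewrite invr_ge0 ltW.
rewrite -ge0_integralD//; last 3 first.
- by move=> x _; rewrite lee_fin ltW.
- by move=> x _; rewrite -EFinM lee_fin mulr_ge0 ?sqr_ge0// invr_ge0 ltW.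
- by apply: measurable_funeM; exact: msq.
apply: ge0_le_integral => //.
- exact: measurable_dist.
- apply: emeasurable_funD; first exact: measurable_cst.
  by apply: measurable_funeM; exact: msq.
move=> x _; rewrite -EFinM -EFinD lee_fin /= -(real_normK (num_real (v x - w x))).
have := normr_ge0 (v x - w x); move: (`|v x - w x|) => t t0.
rewrite [e^-1 * _]mulrC -lerBlDl ler_pdivlMr//.
have : 0 <= (t - e) ^+ 2 + e * t by rewrite addr_ge0 ?sqr_ge0// mulr_ge0// ltW.
by rewrite sqrrB mulrBl !expr2; lra.
Qed.

(** Let s be the supremum of the infima of the squared norm over the K n. Take v n
    in K N with N >= n, of squared norm at most s + 4^-n, with N so large that
    the infimum over K N is at least s - 4^-n. Midpoints of consecutive v n stay
    in one of these sets, and the parallelogram identity bounds the squared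
    distance of v n and v (n+1) by 8 times 4^-n. *)
Lemma nested_convex_cluster K :
  (forall n v, K n v -> unit_valued v) ->
  (forall n, exists v, K n v) ->
  (forall n m, (n <= m)%N -> K m `<=` K n) ->
  (forall n v w, K n v -> K n w -> K n (midpoint v w)) ->
  exists v, unit_valued v /\
    forall n e, 0 < e -> exists2 w, K n w & (L1dist nu setT w v <= e%:E)%E.
Proof.
move=> Ku K0 Knd Kmid.
pose q v := fine (L2sq v).
have q0 v : 0 <= q v by rewrite fine_ge0// L2sq_ge0.
pose c := fine (nu setT).
have nuE : nu setT = c%:E by rewrite /c fineK// ge0_fin_numE.
have c0 : 0 <= c by rewrite fine_ge0.
have qc v : unit_valued v -> q v <= c.
  move=> uv; rewrite /q -lee_fin fineK ?L2sq_fin// -nuE; exact: L2sq_le.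
pose Q n := [set q v | v in K n].
have Qinf n : has_inf (Q n).
  split; first by have [v Kv] := K0 n; exists (q v), v.
  by exists 0 => _ [v _ <-].
pose a n := inf (Q n).
have aq n v : K n v -> a n <= q v.
  by move=> Kv; apply: ge_inf; [case: (Qinf n)|exists v].
have a_nd n m : (n <= m)%N -> a n <= a m.
  move=> nm; apply: lb_le_inf; first by case: (Qinf m).
  by move=> _ [v Kv <-]; apply: aq; exact: Knd Kv.
have supa : has_sup (range a).
  split; first by exists (a 0%N), 0%N.
  exists c => _ [n _ <-]; have [v Kv] := K0 n.
  by rewrite (le_trans (aq n v Kv))// qc//; exact: Ku Kv.
pose s := sup (range a).
have as_ n : a n <= s by apply: ub_le_sup; [case: supa|exists n].
(* 4^-n, because the L^1 distance below is of the order of its square root. *)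
pose del n : R := (4 ^ n)%:R^-1.
have del0 n : 0 < del n by rewrite invr_gt0 ltr0n expn_gt0.
have del_le n : del n.+1 <= del n.
  by rewrite lef_pV2 ?posrE ?ltr0n ?expn_gt0// ler_nat leq_exp2l.
have : forall n, exists v, exists N, [/\ (n <= N)%N, K N v, q v <= s + del n &
    s - del n <= a N].
  move=> n; have [_ [N0 _ <-] sN0] := sup_adherent (del0 n) supa.
  pose N := maxn n N0.
  have [_ [v Kv <-] vN] := inf_adherent (del0 n) (Qinf N).
  exists v, N; split => //; first exact: leq_maxl.
    by rewrite (le_trans (ltW vN))// lerD2r as_.
  by rewrite (le_trans (ltW sN0))// a_nd// leq_maxr.
move=> /choice[v /choice[N vN]].
have uv n : unit_valued (v n) by have [_ /Ku] := vN n.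
have vdist n : fine (L2sq (v n \- v n.+1)) <= 8 * del n /\ L2sq (v n \- v n.+1) \is a fin_num.
  have [_ Kn qn sn] := vN n; have [_ Kn1 qn1 sn1] := vN n.+1.
  pose M := minn (N n) (N n.+1).
  have Km : K M (midpoint (v n) (v n.+1)).
    by apply: Kmid; [apply: Knd Kn; exact: geq_minl|apply: Knd Kn1; exact: geq_minr].
  have sM : s - del n <= a M.
    rewrite /M; case: (leqP (N n) (N n.+1)) => // _.
    by rewrite (le_trans _ sn1)// lerD2l lerN2.
  have := parallelogram (proj1 (uv n)) (proj1 (uv n.+1)).
  have fm := L2sq_fin (Ku _ _ Km).
  have fn := L2sq_fin (uv n); have fn1 := L2sq_fin (uv n.+1).
  have qm := aq _ _ Km; rewrite /q in qm qn qn1.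
  rewrite -(fineK fm) -(fineK fn) -(fineK fn1) -!EFinM -EFinD.
  case: (L2sq (v n \- v n.+1)) => [r| |]//; rewrite -EFinD => -[rE] /=; split => //.
  have := del_le n.
  move: (fine _) (fine _) (fine _) qm qn qn1 rE => x y z qm qn qn1 rE; lra.
pose C := 2 * (c + 8).
have C0 : 0 <= C by rewrite mulr_ge0// addr_ge0.
have [n|v' [uv' cv']] := fast_cauchy_cvg C0 uv.
  have [vd vf] := vdist n.
  have e0 : 0 < (2 ^ n)%:R^-1 :> R by rewrite invr_gt0 ltr0n expn_gt0.
  (* With e = 2^-n both terms of this bound are of order 2^-n. *)
  rewrite (le_trans (L1dist_L2sq e0 (proj1 (uv _)) (proj1 (uv _))))//.
  rewrite nuE -(fineK vf) invrK -!EFinM -EFinD lee_fin.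
  apply: (@le_trans _ _ ((2 ^ n)%:R^-1 * c + (2 ^ n)%:R * (8 * del n))).
    by rewrite lerD2l ler_wpM2l.
  have -> : (2 ^ n)%:R * (8 * del n) = 8 * (2 ^ n)%:R^-1 :> R.
    rewrite /del -[4%N]/(2 * 2)%N expnMn natrM; field.
    by rewrite pnatr_eq0 -lt0n expn_gt0.
  rewrite /C expnS natrM; have -> : 2 * (c + 8) / (2 * (2 ^ n)%:R) = (c + 8) / (2 ^ n)%:R :> R.
    by field; rewrite pnatr_eq0 -lt0n expn_gt0.
  by rewrite [leRHS]mulrDl [X in _ <= X + _]mulrC.
exists v'; split => // n e e0.
move/fine_cvgP : cv' => [finv /cvgr0Pnorm_le /(_ _ e0) ve].
have [k _ /(_ (maxn n k) (leq_maxr _ _)) [fk vk]] := filterI finv ve.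
exists (v (maxn n k)).
  have [nN Kv _ _] := vN (maxn n k).
  by apply: Knd Kv; rewrite (leq_trans _ nN)// leq_maxl.
by rewrite -(fineK fk) lee_fin (le_trans (ler_norm _)).
Qed.

End fast_cauchy.

(** * Restriction of the measure, bounded functions *)

Section restriction.
Context (R : realType) (d : measure_display) (X : completeMetricBorelType R d).
Implicit Types (m mu : {measure set X -> \bar R}) (f g u v : X -> R) (A B : set X).

Lemma tvar_open_subset mu A B u : open A -> open B -> A `<=` B ->
  (tvar_open mu u A <= tvar_open mu u B)%E.
Proof.
move=> oA oB AB; apply: le_ereal_inf_tmp => _ [f [lf fu] <-].
have mA : measurable A by exact: open_borel.
have mB : measurable B by exact: open_borel.
apply: ge_ereal_inf; exists (limn_einf (fun n => \int[mu]_(x in A) slope (f n) x)%E).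
  exists f => //; split=> [n x Ax|x].
    have [U [oU Ux UB LU]] := lf n x (AB _ Ax).
    exists (U `&` A); split => //; first exact: openI.
    by case: LU => L LU; exists L => y z [Uy _] [Uz _]; exact: LU.
  have [U [oU Ux iu if_ cvu]] := fu x.
  have mAU : measurable (A `&` U) by apply: measurableI; exact: open_borel.
  have mBU : measurable (B `&` U) by apply: measurableI; exact: open_borel.
  have ABU : A `&` U `<=` B `&` U by apply: setSI.
  exists U; split => //.
  - exact: integrableS iu.
  - by move=> n; exact: integrableS (if_ n).
  apply: (squeeze_cvge _ (cvg_cst 0%E) cvu); apply: nearW => n.
  apply/andP; split; first by apply: integral_ge0.
  apply: ge0_subset_integral => //.
  apply: measurable_dist; apply/measurable_EFinP.
    by have /integrableP[] := if_ n.
  by have /integrableP[] := iu.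
apply: le_limn_einf => n; apply: ge0_subset_integral => //.
  exact: measurable_slope.
by move=> x _; exact: slope_ge0.
Qed.

Lemma tvar_openE mu u A : open A -> tvar mu u A = tvar_open mu u A.
Proof.
move=> oA; apply/eqP; rewrite eq_le; apply/andP; split.
  apply: ge_ereal_inf; exists (tvar_open mu u A); last exact: lexx.
  by exists A => //; split.
by apply: le_ereal_inf_tmp => _ [B [oB AB] <-]; exact: tvar_open_subset.
Qed.

Lemma mrestrT m : mrestr m measurableT = m :> {measure set X -> \bar R}.
Proof. by apply: eq_measure; apply/funext => S; rewrite /= /mrestr setIT. Qed.

Lemma finite_on_bounded_mrestr m B (mB : measurable B) :
  finite_on_bounded m -> finite_on_bounded (mrestr m mB).
Proof.
move=> finm S mS bS; apply: le_lt_trans (finm _ mS bS).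
by apply: le_measure; rewrite ?inE//; exact: measurableI.
Qed.

Lemma ae_mrestrP m B (mB : measurable B) (P : X -> Prop) :
  {ae mrestr m mB, forall x, P x} <-> {ae m, forall x, B x -> P x}.
Proof.
split=> -[N [mN N0 PN]].
  exists (N `&` B); split => //; first exact: measurableI.
  by move=> x /= /not_implyP[Bx Px]; split => //; exact: PN.
exists (N `|` ~` B); split.
- by apply: measurableU => //; exact: measurableC.
- rewrite /= /mrestr setIUl setICl setU0; apply/eqP.
  rewrite eq_le measure_ge0 andbT -N0; apply: le_measure; rewrite ?inE//.
  exact: measurableI.
move=> x /= Px; have [Bx|] := pselect (B x); last by right.
by left; apply: PN => /= /(_ Bx).
Qed.

Lemma Lfun_oo_bounded mu u : u \in Lfun mu +oo%E -> measurable_fun setT u /\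
  exists2 M, 0 < M & {ae mu, forall x, `|u x| <= M}.
Proof.
move=> /andP[]; rewrite !inE => mfu uf; split => //.
have [mu0|mu0] := ltP 0%E (mu setT).
  rewrite /finite_norm Lnorm.unlock mu0 in uf.
  have [M uM] : exists M, {ae mu, forall x, `|u x| <= M}.
    exact: (@ess_supr_bounded _ _ _ mu (fun x => `|u x|)).
  exists (Num.max 1 M); first by rewrite lt_max ltr01.
  by apply: filterS uM => x xM; rewrite (le_trans xM)// le_max lexx orbT.
exists 1 => //.
exists setT; split => //; apply/eqP; by rewrite eq_le mu0 measure_ge0.
Qed.

Lemma bounded_measurable_Lfun mu u : bounded_measurable u -> u \in Lfun mu +oo%E.
Proof.
move=> [mfu [M uM]]; apply/andP; rewrite !inE; split => //.
rewrite /finite_norm Lnorm.unlock; have [mu0|_] := ltP 0%E (mu setT); last exact: ltry.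
apply: (@le_lt_trans _ _ M%:E); last exact: ltry.
by apply/ess_supP; apply: nearW => x /=; rewrite lee_fin.
Qed.

Lemma bounded_measurable_L1loc mu u : finite_on_bounded mu ->
  bounded_measurable u -> L1loc mu u.
Proof.
move=> finm bu; split; first by case: bu.
move=> x; exists (ball point (mdist point x + 1)).
have oB : open (ball (point : X) (mdist point x + 1)) by exact: open_ballX.
split => //; first by rewrite ballEmdist/= ltrDl.
case: bu => mfu [M uM].
apply: measurable_bounded_integrable => //.
- exact: open_borel.
- apply: finm; first exact: open_borel.
  by exists point, (mdist point x + 1).
- exact: measurable_funTS.
- exists M; split; first exact: num_real.
  by move=> r Mr y _ /=; rewrite (le_trans (uM y))// ltW.
Qed.

End restriction.

(** * Extension of functions with values in the unit interval *)

(** The first conclusion carries the induction: when x is beyond the n-th node,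
    all the steps so far are complete. *)
Lemma staircase (R : realType) (h x : R) (t : nat -> R) : 0 < h -> 0 <= x ->
  (forall i, i%:R * h <= t i < i.+1%:R * h) ->
  forall n, (n%:R * h <= x -> \sum_(i < n) h * (t i < x)%R%:R = n%:R * h) /\
    (x < n%:R * h -> `|x - \sum_(i < n) h * (t i < x)%R%:R| <= h).
Proof.
move=> h0 x0 tP; elim => [|n [IH1 IH2]].
  by rewrite big_ord0 mul0r; split => // /(le_lt_trans x0); rewrite ltxx.
have nS : n.+1%:R * h = n%:R * h + h by rewrite -natr1 mulrDl mul1r.
have /andP[nt tn] := tP n.
rewrite !big_ord_recr/=; have [nx|xn] := leP (n%:R * h) x.
  rewrite IH1//; split => [nx'|xn'].
    by rewrite (lt_le_trans tn)// mulr1 nS.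
  case: (t n < x); rewrite ?mulr1 ?mulr0 ?addr0.
    by rewrite ler_norml; apply/andP; split; lra.
  by rewrite ler_norml; apply/andP; split; lra.
have -> : (t n < x) = false by apply/negbTE; rewrite -leNgt (le_trans (ltW xn)).
rewrite mulr0 addr0; split => [nx|_]; last exact: IH2.
by have := le_lt_trans nx xn; rewrite nS gtrDl ltNge ltW.
Qed.

Section extension.
Context (R : realType) (d : measure_display) (X : completeMetricBorelType R d).
Context (m : {measure set X -> \bar R}) (sepX : separable X) (finm : finite_on_bounded m).
Context (Omega : set X) (oOmega : open Omega).
Implicit Types (u v : X -> R).

Let mOmega : measurable Omega := open_borel oOmega.
Let mO : {measure set X -> \bar R} := mrestr m mOmega.
Let finmO : finite_on_bounded mO. Proof. exact: finite_on_bounded_mrestr. Qed.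

Local Notation V_ u := (tvar_open mO u Omega).
Local Notation VX u := (tvar_open m u setT).

Lemma unit_valued_bounded u : unit_valued u -> bounded_measurable u.
Proof.
move=> [mfu u01]; split => //; exists 1 => x; have /andP[? ?] := u01 x.
by rewrite ger0_norm.
Qed.

Lemma tvar_open_ae_eqO u v : measurable_fun setT u -> measurable_fun setT v ->
  ae_eq m Omega u v -> V_ u = V_ v.
Proof.
move=> mfu mv uv; apply: tvar_open_ae_eq => //.
by apply/ae_mrestrP; apply: filterS uv => x uvx Ox _; exact: uvx.
Qed.

(** On each ball of the exhaustion m is at most a multiple of nu, so the distance
    is 0 in L^1(m) there, and countably many balls are enough. *)
Lemma L1dist_eq0_ae (nu : {measure set X -> \bar R}) u v : finite_weight m nu ->
  measurable_fun setT u -> measurable_fun setT v ->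
  L1dist nu Omega u v = 0%E -> ae_eq m Omega u v.
Proof.
move=> [nufin num nuB] mfu mv uv0.
have mfuO : measurable_fun Omega u by exact: measurable_funTS.
have mvO : measurable_fun Omega v by exact: measurable_funTS.
have H n : {ae m, forall x, (Omega `&` ball point n%:R) x -> u x = v x}.
  have [c c0 cnu] := nuB n.
  have mOB : measurable (Omega `&` ball (point : X) n%:R).
    by apply: measurableI => //; exact: measurable_ballX.
  have : (\int[m]_(x in Omega `&` ball point n%:R) `|(`|u x - v x|%:E : \bar R)|)%E = 0%E.
    apply/eqP; rewrite eq_le integral_ge0// andbT.
    rewrite (eq_integral (fun x => `|u x - v x|%:E)); last first.
      by move=> x _; rewrite /= normr_id.
    have := @integral_weight_ge _ _ _ m nu Omega (ball point n%:R)
      (fun x => `|u x - v x|%:E) c mOmega (measurable_ballX _ _) c0 cnu.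
    rewrite -/(L1dist nu Omega u v) uv0 => cle.
    rewrite -(@lee_pmul2l _ c%:E)// ?lte_fin//.
    rewrite mule0; apply: cle; first exact: measurable_dist.
    by move=> x _; rewrite lee_fin.
  move/ae_eq_integral_abs => /(_ mOB)[].
    by apply: measurable_dist; exact: measurable_funTS.
  move=> N [mN N0 PN]; exists N; split => // x /= /not_implyP[Ox uvx]; apply: PN => /=.
  by move=> /(_ Ox) [] /eqP; rewrite normr_eq0 subr_eq0 => /eqP.
apply: filterS (ae_foralln H) => x Hx Ox.
have [n xn] : exists n : nat, mdist (point : X) x < n%:R.
  exists (Num.bound (mdist (point : X) x)).
  by apply: archi_boundP; exact: mdist_ge0.
by apply: (Hx n); split => //; rewrite ballEmdist.
Qed.

(** K n consists of the functions with values in [0, 1], variation at most C W and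
    distance at most c / (n+1) to u on Omega. It is convex, and the averages of
    the extended superlevel sets show that it is not empty. The limit point v
    provided by nested_convex_cluster keeps the bound on the variation by lower
    semicontinuity, and is at distance 0 from u on Omega. *)
Lemma extend_unit_valued (C : R) : 0 < C ->
  (forall E, measurable E -> E `<=` Omega -> (V_ \1_E < +oo)%E ->
    exists E', [/\ measurable E', (VX \1_E' <= C%:E * V_ \1_E)%E &
      m (E `+` (E' `&` Omega)) = 0%E]) ->
  forall u (W : R), unit_valued u -> V_ u = W%:E ->
  exists v, [/\ unit_valued v, (VX v <= (C * W)%:E)%E & ae_eq m Omega v u].
Proof.
move=> C0 extE u W uu VW; have bu := unit_valued_bounded uu.
have [mfu u01] := uu.
have [nuO wnuO] := finite_weight_exists finmO.
have [nu wnu] := finite_weight_exists finm.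
have [nufin num _] := wnu.
pose c := fine (nu setT).
have nuE : nu setT = c%:E by rewrite /c fineK// ge0_fin_numE.
have c0 : 0 <= c by rewrite fine_ge0.
have nuOc : (nu Omega <= c%:E)%E.
  by rewrite -nuE; apply: le_measure; rewrite ?inE.
pose K n := [set v | [/\ unit_valued v, (VX v <= (C * W)%:E)%E &
   (L1dist nu Omega v u <= (n.+1%:R^-1 * c)%:E)%E]].
have K0 n : exists v, K n v.
  pose h : R := n.+1%:R^-1.
  have h0 : 0 < h by rewrite invr_gt0.
  have [||t [tP [Vt sumV]]] := coarea_levels sepX finmO wnuO oOmega bu _ h0.
  - by move=> x; have /andP[] := u01 x.
  - by rewrite VW ltry.
  pose E i := [set x | t i < u x] `&` Omega.
  have mE i : measurable (E i).
    by apply: measurableI => //; exact: measurable_superlevel.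
  have VE i : V_ \1_(E i) = V_ \1_[set x | t i < u x].
    apply: tvar_open_ae_eqO; [exact: measurable_indic| |].
      by apply: measurable_indic; exact: measurable_superlevel.
    apply: nearW => x Ox; rewrite !indicE; congr (_%:R); congr nat_of_bool.
    by apply/idP/idP; rewrite !inE => // -[].
  have : forall i, exists E', [/\ measurable E', (VX \1_E' <= C%:E * V_ \1_(E i))%E &
      m (E i `+` (E' `&` Omega)) = 0%E].
    by move=> i; apply: extE => //; [move=> x []|rewrite VE].
  move=> /choice[E' E'P].
  have mE' i : measurable (E' i) by case: (E'P i).
  pose v x := \sum_(i < n.+1) h * \1_(E' i) x.
  have hn : n.+1%:R * h = 1 by rewrite /h divff.
  have v01 x : 0 <= v x <= 1.
    apply/andP; split.
      by apply: sumr_ge0 => i _; rewrite mulr_ge0// ltW.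
    have -> : 1 = \sum_(i < n.+1) h by rewrite sumr_const card_ord -mulr_natl.
    by apply: ler_sum => i _; rewrite ler_piMr ?(ltW h0).
  have uv : unit_valued v.
    split => //; apply: measurable_sum => i.
    by apply: measurable_funM; [exact: measurable_cst|exact: measurable_indic].
  exists v; split => //.
  - pose p i := C * fine (V_ \1_[set x | t i < u x]).
    have pE i : (VX \1_(E' i) <= (p i)%:E)%E.
      rewrite /p EFinM fineK -?VE; first by case: (E'P i).
      by rewrite VE ge0_fin_numE// tvar_open_ge0.
    have vp k : bounded_measurable (fun x => \sum_(i < k) h * \1_(E' i) x) /\
        (VX (fun x => (\sum_(i < k) h * \1_(E' i) x)%R) <= (\sum_(i < k) h * p i)%:E)%E.
      elim: k => [|k [bk Vk]].
        have b0 := bounded_measurable_indic (mE' 0%N).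
        rewrite (_ : (fun x => _) =
          (fun x => 0 * \1_(E' 0%N) x + 0 * \1_(E' 0%N) x + 0)); last first.
          by apply/funext => x; rewrite big_ord0 !mul0r !addr0.
        split; first exact: bounded_measurable_comb.
        have -> : \sum_(i < 0) h * p i = 0 * p 0%N + 0 * p 0%N.
          by rewrite big_ord0 !mul0r addr0.
        exact: (tvar_open_comb sepX finm wnu openT).
      have b1 := bounded_measurable_indic (mE' k).
      rewrite (_ : (fun x => _) =
        (fun x => 1 * (\sum_(i < k) h * \1_(E' i) x) + h * \1_(E' k) x + 0)); last first.
        by apply/funext => x; rewrite big_ord_recr/= addr0 mul1r.
      split; first exact: bounded_measurable_comb.
      rewrite big_ord_recr/= -[X in (_ <= (X + _)%:E)%E]mul1r.
      by apply: (tvar_open_comb sepX finm wnu openT) => //; exact: ltW.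
    apply: (le_trans (proj2 (vp n.+1))); rewrite lee_fin.
    have -> : \sum_(i < n.+1) h * p i =
        C * \sum_(i < n.+1) h * fine (V_ \1_[set x | t i < u x]).
      by rewrite mulr_sumr; apply: eq_bigr => i _; rewrite /p mulrCA.
    apply: ler_wpM2l; first exact: ltW.
    rewrite -lee_fin -VW -sumEFin (le_trans _ (sumV n.+1))//.
    apply: lee_sum => i _; rewrite EFinM fineK//.
    by rewrite ge0_fin_numE// tvar_open_ge0.
  pose s x := \sum_(i < n.+1) h * \1_[set x | t i < u x] x.
  have ms : measurable_fun setT s.
    apply: measurable_sum => i.
    apply: measurable_funM; first exact: measurable_cst.
    by apply: measurable_indic; exact: measurable_superlevel.
  have vs : ae_eq nu Omega v s.
    have mY i : measurable (E i `+` (E' i `&` Omega)).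
      have mI : measurable (E' i `&` Omega) by exact: measurableI.
      by rewrite setY_def; apply: measurableU; exact: measurableD.
    have HY i : {ae nu, forall x, ~ (E i `+` (E' i `&` Omega)) x}.
      exists (E i `+` (E' i `&` Omega)); split => //.
        have [_ _ Y0] := E'P i; apply/eqP.
        by rewrite eq_le measure_ge0 andbT -Y0 num.
      by move=> x /= /contrapT.
    apply: filterS (ae_foralln HY) => x Hx Ox; apply: eq_bigr => i _; congr (_ * _).
    rewrite !indicE; congr (_%:R); congr nat_of_bool.
    have := Hx i; rewrite setY_def => /not_orP[H1 H2].
    apply/idP/idP; rewrite !inE => xi.
      by apply: contrapT => nt; apply: H2; split => // -[].
    by apply: contrapT => nE; apply: H1; split; [split|case].
  have -> : L1dist nu Omega v u = L1dist nu Omega s u.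
    have mv : measurable_fun Omega v by apply: measurable_funTS; exact: (proj1 uv).
    have ms' : measurable_fun Omega s by exact: measurable_funTS.
    have mu' : measurable_fun Omega u by exact: measurable_funTS.
    apply: ge0_ae_eq_integral => //.
    - exact: measurable_dist.
    - exact: measurable_dist.
    by apply: filterS vs => x vsx Ox; rewrite vsx.
  apply: (@le_trans _ _ (h%:E * nu Omega)%E).
    apply: L1dist_le_cst => //; do ?exact: measurable_funTS.
    move=> x _; rewrite distrC.
    have -> : s x = \sum_(i < n.+1) h * (t i < u x)%R%:R.
      by apply: eq_bigr => i _; rewrite (indic_predE _ (fun y => t i < u y)).
    have [S1 S2] := staircase h0 (proj1 (andP (u01 x))) tP n.+1.
    have [ux|ux] := ltP (u x) 1; first by apply: S2; rewrite hn.
    have ux1 : u x = 1 by apply/eqP; rewrite eq_le ux andbT; case/andP: (u01 x).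
    by rewrite ux1 in S1 *; rewrite S1 ?hn// subrr normr0 ltW.
  by rewrite EFinM; apply: lee_wpmul2l => //; rewrite lee_fin ltW.
have Ku n v : K n v -> unit_valued v by case.
have Knd n k : (n <= k)%N -> K k `<=` K n.
  move=> nk v [uv Vv vu]; split => //; apply: (le_trans vu).
  by rewrite lee_fin ler_wpM2r// lef_pV2 ?posrE// ler_nat.
have Kmid n v w : K n v -> K n w -> K n (midpoint v w).
  move=> [uv Vv vu] [uw Vw wu].
  have mE : midpoint v w = (fun x => 2^-1 * v x + 2^-1 * w x + 0).
    by apply/funext => x; rewrite /midpoint addr0 -mulrDr mulrC.
  have bv := unit_valued_bounded uv; have bw := unit_valued_bounded uw.
  have mm : measurable_fun setT (midpoint v w).
    by rewrite mE; case: (bounded_measurable_comb 2^-1 2^-1 0 bv bw).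
  split.
  - split => // x; have /andP[? ?] := proj2 uv x; have /andP[? ?] := proj2 uw x.
    by rewrite /midpoint; apply/andP; split; lra.
  - rewrite mE.
    have -> : C * W = 2^-1 * (C * W) + 2^-1 * (C * W) by field.
    exact: (tvar_open_comb sepX finm wnu openT).
  have mvO : measurable_fun Omega v by apply: measurable_funTS; exact: (proj1 uv).
  have mwO : measurable_fun Omega w by apply: measurable_funTS; exact: (proj1 uw).
  have muO : measurable_fun Omega u by exact: measurable_funTS.
  have mmO : measurable_fun Omega (midpoint v w) by exact: measurable_funTS.
  have i2 : 0 <= 2^-1 :> R by rewrite invr_ge0.
  apply: (le_trans (L1dist_comb nu mOmega mvO mwO mmO muO muO muO i2 i2 _)).
    move=> x _; rewrite mE.
    have -> : 2^-1 * v x + 2^-1 * w x + 0 - u x =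
        2^-1 * (v x - u x) + 2^-1 * (w x - u x) by field.
    by rewrite (le_trans (ler_normD _ _))// !normrM ger0_norm.
  apply: (@le_trans _ _ (2^-1%:E * (n.+1%:R^-1 * c)%:E + 2^-1%:E * (n.+1%:R^-1 * c)%:E)%E).
    by apply: leeD; apply: lee_wpmul2l.
  by rewrite -!EFinM -EFinD lee_fin; move: (_ * c) => Y; lra.
have [v [uv vK]] := nested_convex_cluster nufin Ku K0 Knd Kmid.
have bv := unit_valued_bounded uv; have mv := proj1 uv.
exists v; split => //.
  apply: (tvar_open_lsc sepX finm wnu openT) => // e e0.
  have [w [uw Vw _] wv] := vK 0%N e e0; exists w; split => //.
    exact: unit_valued_bounded.
  by rewrite (le_trans Vw)// lee_fin lerDl ltW.
apply: (L1dist_eq0_ae wnu) => //; apply/eqP; rewrite eq_le L1dist_ge0 andbT.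
apply/lee_addgt0Pr => e e0; rewrite add0e.
have e20 : 0 < e / 2 by rewrite divr_gt0.
have c1 : 0 < c + 1 by rewrite ltr_wpDl.
have [n _ /(_ _ (leqnn _)) /= ne] := near_infty_natSinv_lt (PosNum (divr_gt0 e20 c1)).
have [w [uw _ wu] wv] := vK n _ e20.
have mvO : measurable_fun Omega v by exact: measurable_funTS.
have mwO : measurable_fun Omega w by apply: measurable_funTS; exact: (proj1 uw).
have mfO : measurable_fun Omega u by exact: measurable_funTS.
apply: (le_trans (L1dist_triangle nu mOmega mvO mwO mfO)).
rewrite [e in leRHS]splitr EFinD; apply: leeD.
  rewrite L1distC; apply: le_trans wv; apply: ge0_subset_integral => //.
  by apply: measurable_dist => //; exact: (proj1 uw).
rewrite (le_trans wu)// lee_fin.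
apply: (@le_trans _ _ (e / 2 / (c + 1) * c)); first by rewrite ler_wpM2r// ltW.
rewrite mulrAC ler_pdivrMr//; apply: ler_wpM2l; first exact: ltW.
by rewrite lerDl.
Qed.

End extension.

(** * Extension of functions and of sets *)

Section main.
Context (R : realType) (d : measure_display) (X : completeMetricBorelType R d).
Context (m : {measure set X -> \bar R}) (sepX : separable X) (finm : finite_on_bounded m).
Context (Omega : set X) (oOmega : open Omega).
Implicit Types (u v : X -> R) (E : set X).

Local Notation mO := (mrestr m (open_borel oOmega)).

Lemma bv_normE u : bv_norm m (open_borel oOmega) u = tvar_open mO u Omega.
Proof. exact: tvar_openE. Qed.

Lemma bv_normTE u : bv_norm m measurableT u = tvar_open m u setT.
Proof. by rewrite /bv_norm mrestrT; apply: tvar_openE; exact: openT. Qed.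

Lemma perimeterTE E : perimeter m E setT = tvar_open m \1_E setT.
Proof. by apply: tvar_openE; exact: openT. Qed.

Lemma ae_eq_clamp (mu : {measure set X -> \bar R}) u (M : R) :
  {ae mu, forall x, `|u x| <= M} -> {ae mu, forall x, (clamp (- M) M \o u) x = u x}.
Proof.
by apply: filterS => x uM; rewrite /= clamp_id// -ler_norml.
Qed.

(** The truncation of the extension w to [-M, M] changes nothing almost everywhere
    and makes it bounded. A level t in [0, 1) separates the two values that w
    takes on Omega. *)
Lemma perimeter_extension :
  BV_Linfty_extension_set m (open_borel oOmega) ->
  perimeter_extension_property m (open_borel oOmega).
Proof.
move=> [C C0 [Ext [ExtP _]]]; exists C => // E mE EO PE.
have finmO : finite_on_bounded mO by exact: finite_on_bounded_mrestr.
have b1 := bounded_measurable_indic mE.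
have BVE : BV_Linfty m (open_borel oOmega) \1_E.
  split; first by split => //; exact: bounded_measurable_L1loc.
  exact: bounded_measurable_Lfun.
have [[[[mw _] Vw] /Lfun_oo_bounded[_ [M M0 wM]]] Vle wE] := ExtP _ BVE.
move: (Ext \1_E) mw Vw wM Vle wE => w mw Vw wM' Vle wE.
have /ae_mrestrP wM := ae_eq_clamp wM'.
pose w' := clamp (- M) M \o w.
have bw' : bounded_measurable w' by exact: bounded_measurable_clamp.
have mw' : measurable_fun setT w' by case: bw'.
have [nu wnu] := finite_weight_exists finm.
have VwE : tvar_open m w' setT = tvar_open m w setT.
  by apply: tvar_open_ae_eq => //; exact: openT.
rewrite bv_normTE in Vw Vle.
have Vc : (tvar_open m (clamp 0 1 \o w') setT <= tvar_open m w setT)%E.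
  by rewrite -VwE; exact: (tvar_open_clamp sepX finm wnu openT).
have [||t [t0 t1]] := coarea_level sepX finm wnu openT bw' (a := 0) (b := 1).
- exact: ltr01.
- exact: le_lt_trans Vw.
rewrite subr0 mul1e => Vt.
exists [set x | t < w' x]; split.
- exact: measurable_superlevel.
- by rewrite perimeterTE (le_trans Vt)// (le_trans Vc).
have mE' : measurable [set x | t < w' x] by exact: measurable_superlevel.
apply: measure_negligible.
  have mI : measurable ([set x | t < w' x] `&` Omega).
    by apply: measurableI => //; exact: open_borel.
  by rewrite setY_def; apply: measurableU; exact: measurableD.
have : {ae m, forall x, ~ (E `+` ([set x | t < w' x] `&` Omega)) x}.
  apply: filterS2 wM wE => x /(_ I) w'x wx; rewrite setY_def /= => -[[Ex nE']|[[wt Ox] nE]].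
    apply: nE'; split; last exact: EO.
    rewrite /w' w'x wx; last exact: EO.
    by rewrite indicE mem_set.
  move: wt; rewrite /w' w'x wx// indicE memNset// => /lt_geF.
  by rewrite t0.
by apply: negligibleS => x /= Hx /(_ Hx).
Qed.

(** The affine map from [-M, M] onto [0, 1] divides the variation by 2 M, and its
    inverse multiplies it by 2 M. *)
Lemma extend_bounded (C : R) : 0 < C ->
  (forall E, measurable E -> E `<=` Omega ->
    (perimeter_in m (open_borel oOmega) E < +oo)%E ->
      exists E' : set X, [/\ measurable E',
        (perimeter m E' setT <= C%:E * perimeter_in m (open_borel oOmega) E)%E &
        m (E `+` (E' `&` Omega)) = 0%E]) ->
  forall u, BV_Linfty m (open_borel oOmega) u ->
  exists v, [/\ BV_Linfty m measurableT v,
    (bv_norm m measurableT v <= C%:E * bv_norm m (open_borel oOmega) u)%E &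
    ae_eq m Omega v u].
Proof.
move=> C0 extE u [[[mfu _] Vu] /Lfun_oo_bounded[_ [M M0 uM']]]; have uM := ae_eq_clamp uM'.
have finmO : finite_on_bounded mO by exact: finite_on_bounded_mrestr.
have [nuO wnuO] := finite_weight_exists finmO.
have [nu wnu] := finite_weight_exists finm.
pose u1 := clamp (- M) M \o u.
have bu1 : bounded_measurable u1 by exact: bounded_measurable_clamp.
have mu1 : measurable_fun setT u1 by case: bu1.
have Vu1 : tvar_open mO u1 Omega = tvar_open mO u Omega.
  by apply: tvar_open_ae_eq => //; apply: filterS uM => x.
rewrite bv_normE in Vu; rewrite bv_normE.
have [W WE] : exists W, tvar_open mO u Omega = W%:E.
  by exists (fine (tvar_open mO u Omega)); rewrite fineK// ge0_fin_numE// tvar_open_ge0.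
pose u0 x := (2 * M)^-1 * u1 x + 0 * u1 x + 2^-1.
have M20 : 0 < 2 * M by rewrite mulr_gt0.
have bu0 : bounded_measurable u0 by exact: bounded_measurable_comb.
have u1M x : - M <= u1 x <= M.
  rewrite -ler_norml; apply: clamp_bound; by rewrite ?normrN ger0_norm// ltW.
have uu0 : unit_valued u0.
  split; first by case: bu0.
  move=> x; have /andP[u1l u1r] := u1M x.
  have -> : u0 x = (u1 x + M) / (2 * M).
    by rewrite /u0; field; rewrite gt_eqF.
  apply/andP; split; last by rewrite ler_pdivrMr//; lra.
  by apply: divr_ge0; [lra|exact: ltW].
have Vu0 : (tvar_open mO u0 Omega <= ((2 * M)^-1 * W)%:E)%E.
  rewrite -[X in (_ <= X%:E)%E]addr0 -(mul0r W).
  have Vu1W : (tvar_open mO u1 Omega <= W%:E)%E by rewrite Vu1 WE.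
  have i2M : 0 <= (2 * M)^-1 by rewrite invr_ge0 ltW.
  exact: (tvar_open_comb sepX finmO wnuO oOmega).
have [W0 W0E] : exists W, tvar_open mO u0 Omega = W%:E.
  exists (fine (tvar_open mO u0 Omega)).
  rewrite fineK// ge0_fin_numE ?tvar_open_ge0//.
  by rewrite (le_lt_trans Vu0)// ltry.
have [|v0 [uv0 Vv0 v0u]] := extend_unit_valued sepX finm C0 _ uu0 W0E.
  move=> E mE EO VE; have [|E' [mE' PE' E'0]] := extE E mE EO.
    by rewrite /perimeter_in bv_normE.
  by exists E'; split => //; rewrite -perimeterTE -bv_normE.
pose v x := (2 * M) * v0 x + 0 * v0 x + (- M).
have bv0 := unit_valued_bounded uv0.
have bv : bounded_measurable v by exact: bounded_measurable_comb.
have Vv : (bv_norm m measurableT v <= C%:E * tvar_open mO u Omega)%E.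
  rewrite bv_normTE WE -EFinM.
  apply: (@le_trans _ _ ((2 * M) * (C * W0) + 0 * (C * W0))%:E).
    by apply: (tvar_open_comb sepX finm wnu openT) => //; exact: ltW.
  move: Vu0; rewrite W0E !lee_fin mul0r addr0 mulrCA => Vu0.
  by apply: ler_wpM2l; [exact: ltW|rewrite -ler_pdivlMl].
exists v; split => //.
- split.
    split; last by rewrite (le_lt_trans Vv)// WE -EFinM ltry.
    by rewrite mrestrT; exact: bounded_measurable_L1loc.
  exact: bounded_measurable_Lfun.
move/ae_mrestrP : uM => uM.
apply: filterS2 v0u uM => x v0x ux Ox; rewrite /v v0x// /u0 -(ux Ox) /u1 /=.
by field; rewrite gt_eqF.
Qed.

(** The set of admissible extensions of u only depends on the class of u, so
    choosing an element of this set defines a map of classes. *)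
Lemma BV_Linfty_extension :
  perimeter_extension_property m (open_borel oOmega) ->
  BV_Linfty_extension_set m (open_borel oOmega).
Proof.
move=> [C C0 extE]; exists C => //.
pose G u := [set v | [/\ BV_Linfty m measurableT v,
    (bv_norm m measurableT v <= C%:E * bv_norm m (open_borel oOmega) u)%E &
    ae_eq m Omega v u]].
exists (fun u => xget (cst 0) (G u)); split.
  move=> u /(extend_bounded C0 extE)[v Gv].
  by have := xgetPex (cst 0) (ex_intro _ v Gv : exists v, G u v).
move=> u v [[[mfu _] _] _] [[[mv _] _] _] uv.
(* Equality of the two sets makes the chosen elements equal. *)
suff -> : G u = G v by exact: ae_eq_refl.
have Vuv : bv_norm m (open_borel oOmega) u = bv_norm m (open_borel oOmega) v.
  by rewrite !bv_normE; exact: tvar_open_ae_eqO.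
rewrite /G -Vuv; apply/seteqP; split => w [Bw Vw wu]; split.
- exact: Bw.
- exact: Vw.
- exact: ae_eq_trans uv.
- exact: Bw.
- exact: Vw.
- by apply: ae_eq_trans wu _; exact: ae_eq_sym.
Qed.

End main.

Theorem theorem1p2 (R : realType) (d : measure_display)
    (X : completeMetricBorelType R d) (m : {measure set X -> \bar R})
    (sepX : separable X) (finm : finite_on_bounded m)
    (Omega : set X) (oOmega : open Omega) :
  BV_Linfty_extension_set m (open_borel oOmega) <->
  perimeter_extension_property m (open_borel oOmega).
Proof.
split; first exact: perimeter_extension.
exact: BV_Linfty_extension.
Qed.
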